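(* For $\beta\ge 1$ and an integer $N\ge 1$ let $H=\left\lfloor \frac{1}{4\beta}\log N\right\rfloor$. The following two statements hold. (i) There exist two universal constants $C,K>0$ (not depending on $\beta$, $h$, $N$, $m$) such that for all $\beta\ge 1$, all $h\in(0,h_w(\beta))$, all integers $N\ge 1$ and all integers $m\ge K$, $$\mathbb{P}_N^{\beta,h}\left(\left|\phi^{-1}([H+m,\infty))\right|>e^{-2\beta m}N^2\right)\le \exp\left(-Ce^{-2\beta m}N\left(1\wedge e^{-2\beta m}N(\log N)^{-8}\right)\right).$$ (ii) For all $\beta\ge 1$, all $h\in(0,h_w(\beta))$, all integers $N\ge 1$, all $\delta>0$ and all $m\in\mathbb{N}$, $$\mathbb{P}_N^{\beta,h}\left(\left|\phi^{-1}([0,H-m])\right|>2e^{-2\beta m}N^2\right)\le 3\exp\left(-\min\left(\tfrac12 e^{2\beta m}-4\beta(1+\kappa),\ \delta\right)N\right),$$ where $$\kappa=\kappa(\beta,h,\delta)=\frac{4\beta+\delta}{\log\left(e^{-h}+e^{-4\beta}\right)}.$$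
   Context: For an integer $N\ge1$, $\Lambda_N=\{1,\dots,N\}^2\subset\mathbb{Z}^2$; $x\sim y$ means that $x,y$ are nearest neighbors in $\mathbb{Z}^2$; $\partial\Lambda_N=\{x\in\mathbb{Z}^2\setminus\Lambda_N:\exists y\in\Lambda_N,\ x\sim y\}$. Let $\mathbb{Z}_+=\{0,1,2,\dots\}$ and $\Omega_N=\mathbb{Z}_+^{\Lambda_N}$. For $\phi\in\Omega_N$ the Hamiltonian with zero boundary condition is $$\mathcal{H}_N(\phi)=\sum_{\{x,y\}\subset\Lambda_N,\ x\sim y}|\phi(x)-\phi(y)|+\sum_{x\in\Lambda_N,\ y\in\partial\Lambda_N,\ x\sim y}|\phi(x)|.$$ For $A\subset\mathbb{Z}$ or $A\subset \mathbb{R}$, $\phi^{-1}(A)=\{x\in\Lambda_N:\phi(x)\in A\}$, and $\phi^{-1}(k)=\phi^{-1}(\{k\})$; $|\cdot|$ of a finite set is its cardinality. For $\beta>0$, $h\ge0$, the probability measure $\mathbb{P}_N^{\beta,h}$ on $\Omega_N$ (solid-on-solid surface above a wall with pinning) is $$\mathbb{P}_N^{\beta,h}(\phi)=\frac{1}{\mathcal{Z}_N^{\beta,h}}\,e^{-\beta\mathcal{H}_N(\phi)+h|\phi^{-1}(0)|},\qquad \mathcal{Z}_N^{\beta,h}=\sum_{\phi\in\Omega_N}e^{-\beta\mathcal{H}_N(\phi)+h|\phi^{-1}(0)|}<\infty.$$ The critical pinning parameter is $h_w(\beta)=\log\left(\frac{e^{4\beta}}{e^{4\beta}-1}\right)$;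 thus $e^{-h}+e^{-4\beta}>1$ for $h\in[0,h_w(\beta))$. Notation: $a\wedge b=\min(a,b)$; for $N=1$, $(\log N)^{-8}$ is read as $+\infty$. $\mathbb{N}=\{1,2,\dots\}$. *)

(* Defs.v *)
From HB Require Import structures.
From mathcomp Require Import all_boot all_order all_algebra.
From mathcomp Require Import all_classical all_reals all_analysis.
Set Implicit Arguments.
Unset Strict Implicit.
Unset Printing Implicit Defensive.
Import Order.TTheory GRing.Theory Num.Theory.
Local Open Scope classical_set_scope.
Local Open Scope ring_scope.

(* The nearest neighbors of [z] in Z^2, without repetition. *)
Definition nbrs (z : int * int) : seq (int * int) :=
  [:: (z.1 + 1, z.2); (z.1 - 1, z.2); (z.1, z.2 + 1); (z.1, z.2 - 1)].

Definition nn (x y : int * int) : bool := y \in nbrs x.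

Definition box (N : nat) : pred (int * int) :=
  fun z => (1 <= z.1 <= N%:Z) && (1 <= z.2 <= N%:Z).

(* The existential over [y] in the box with [x ~ y] is a search among the four
   neighbors of [x]. *)
Definition bdry (N : nat) : pred (int * int) :=
  fun x => ~~ box N x && has (box N) (nbrs x).

(* [site N] is the box [{1, ..., N}^2] as a finite type; ordinals start at 0,
   hence the shift by one in [pt]. *)
Definition site (N : nat) : finType := ('I_N * 'I_N)%type.

Definition pt (N : nat) (x : site N) : int * int :=
  (x.1.+1%:Z, x.2.+1%:Z).

Definition surface (N : nat) : countType := {ffun site N -> nat}.

(* The inverse image of a set of integers under [phi]. *)
Definition preim_level (N : nat) (phi : surface N) (A : {pred int}) :
    {set site N} :=
  [set x | (phi x)%:Z \in A]%SET.

Section SolidOnSolid.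
Variables (R : realType) (N : nat).
Implicit Types (beta h : R) (phi : surface N).

(* The double sum in the first term runs over ordered pairs, so it counts each
   unordered pair of neighbors twice. *)
Definition hamiltonian phi : R :=
  2^-1 * (\sum_(x : site N) \sum_(y : site N | nn (pt x) (pt y))
            `|(phi x)%:R - (phi y)%:R|)
  + \sum_(x : site N) \sum_(y <- nbrs (pt x) | bdry N y) `|(phi x)%:R|.

Definition weight beta h phi : R :=
  expR (- beta * hamiltonian phi + h * #|preim_level phi (pred1 (0 : int))|%:R).

Definition partition_function beta h : \bar R :=
  \esum_(phi in [set: surface N]) (weight beta h phi)%:E.

Definition sos_mass beta h phi : \bar R :=
  ((weight beta h phi)%:E / partition_function beta h)%E.

Definition sos_prob beta h (E : set (surface N)) : \bar R :=
  \esum_(phi in E) sos_mass beta h phi.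

End SolidOnSolid.

Definition wetting_point (R : realType) (beta : R) : R :=
  ln (expR (4 * beta) / (expR (4 * beta) - 1)).

Definition typical_height (R : realType) (beta : R) (N : nat) : int :=
  Num.floor ((4 * beta)^-1 * ln (N%:R : R)).

Definition kappa (R : realType) (beta h delta : R) : R :=
  (4 * beta + delta) / ln (expR (- h) + expR (- (4 * beta))).

(* Main.v *)
(* The Hamiltonian is the total perimeter of the level sets, so all estimates come
   from shifting a surface by one on a set of sites and, where this is not
   injective enough, letting some sites fall back to height 0 or 1.

   Part (ii). Lift all nonzero sites by one and drop an arbitrary subset [D] of the
   sites of one level [k > 0] to the vacated height 1. Each dropped site costs a
   factor [exp (- 4 beta k)], the lift costs [exp (- 4 beta (N + #zeros))], and since
   [D] is arbitrary the gain is exponential in the size of the level. The number of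
   zeros is bounded by lifting the whole surface and dropping some of the former
   zeros back to 0, which gains [exp (- h) + exp (- 4 beta) > 1] per zero.

   Part (i). Tilt the measure by [exp (theta / N)] to the number of sites above level
   [H + m]. By the inequalities of Chernoff and Jensen it is enough to bound by
   [exp (- 2 beta m) / 2] the probability that a given site is that high under the
   tilted measure. Such a site is enclosed by a contour at every level below
   [H + m], and lowering the inside of a contour [T] gains [exp (beta |dT|)],
   provided the inside has no zero. Zeros inside [T] have probability
   [O (exp (- 4 beta l))], because they are in turn enclosed by contours at all
   levels below [l]; raising the inside of those is always allowed, and [h < h_w]
   pays for the lost pinning. Both arguments are recursions over increasing chains
   of contours, which converge as soon as [sum exp (- c |dT|)] over contours around
   a point is finite for some [c < 1]; since [beta = 1] is allowed, this needs that
   the number of self-avoiding walks grows more slowly than [exp n]. *)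
Require Import Defs.
From HB Require Import structures.
From Stdlib Require Import BinNat.
From mathcomp Require Import all_boot all_order all_algebra zify ring lra.
From mathcomp Require Import all_classical all_reals all_analysis.
Set Implicit Arguments.
Unset Strict Implicit.
Unset Printing Implicit Defensive.
Import Order.TTheory GRing.Theory Num.Theory.

(** * Growth of self-avoiding walks *)

Inductive dir := East | North | West | South.

Definition lft d :=
  match d with East => North | North => West | West => South | South => East end.

Definition rgt d :=
  match d with East => South | North => East | West => North | South => West end.

Definition step (v : int * int) d : int * int :=
  match d with
  | East => (v.1 + 1, v.2)%R
  | North => (v.1, v.2 + 1)%R
  | West => (v.1 - 1, v.2)%R
  | South => (v.1, v.2 - 1)%R
  end.

(* [Some true] is a left turn, [Some false] a right turn, [None] no turn. *)
Definition turn (t : option bool) d :=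
  match t with Some true => lft d | Some false => rgt d | None => d end.

Fixpoint walk (v : int * int) d (w : seq (option bool)) : seq (int * int) :=
  v :: (if w is t :: w' then walk (step v d) (turn t d) w' else [:: step v d]).

(** A word of [n] turns describes [n + 2] vertices, because a step precedes the first turn. The base
    point and the initial direction are immaterial by [uniq_walk]. *)
Definition saw w := uniq (walk (0, 0)%R North w).

Lemma walk_translate (a v : int * int) d w :
  walk (v.1 + a.1, v.2 + a.2)%R d w =
  [seq (u.1 + a.1, u.2 + a.2)%R | u <- walk v d w].
Proof.
have E u e : step (u.1 + a.1, u.2 + a.2)%R e =
             ((step u e).1 + a.1, (step u e).2 + a.2)%R.
  by case: e => /=; congr (_, _); rewrite addrAC.
by elim: w v d => [|t w IHw] v d /=; rewrite E // IHw.
Qed.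

Lemma walk_rotate (v : int * int) d w :
  walk (- v.2, v.1)%R (lft d) w = [seq (- u.2, u.1)%R | u <- walk v d w].
Proof.
have E u e : step (- u.2, u.1)%R (lft e) = (- (step u e).2, (step u e).1)%R.
  by case: e => /=; congr (_, _); rewrite ?opprD ?opprK.
elim: w v d => [|t w IHw] v d /=; rewrite E //; congr (_ :: _).
by rewrite -IHw; congr walk; case: t => [[]|] //; case: d.
Qed.

(** Translations and quarter turns only relabel the vertices of a walk, and together they bring any
    base point and direction to [(0, 0)] and [North]. *)
Lemma uniq_walk v d w : uniq (walk v d w) = saw w.
Proof.
have tr u e : uniq (walk u e w) = uniq (walk (0, 0)%R e w).
  have {1}-> : u = ((0 : int, 0 : int).1 + u.1, (0 : int, 0 : int).2 + u.2)%R.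
    by rewrite !add0r -surjective_pairing.
  rewrite walk_translate map_inj_uniq //.
  by move=> [x y] [x' y'] /= [/addIr -> /addIr ->].
have rot e : uniq (walk (0, 0)%R (lft e) w) = uniq (walk (0, 0)%R e w).
  have {1}-> : (0 : int, 0 : int)%R = (- (0 : int, 0 : int).2, (0 : int, 0 : int).1)%R.
    by rewrite oppr0.
  rewrite walk_rotate map_inj_uniq //.
  by move=> [x y] [x' y'] /= [/oppr_inj -> ->].
rewrite tr /saw; case: d => //.
- by rewrite -[North]/(lft East) rot.
- by rewrite -[West]/(lft North) rot.
- by rewrite -[South]/(lft (lft North)) !rot.
Qed.

Lemma saw_cons t w : saw (t :: w) -> saw w.
Proof. by rewrite {1}/saw /= => /andP[_]; rewrite uniq_walk. Qed.

Lemma saw_prefix p w : saw (p ++ w) -> saw p.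
Proof.
have [s Es] : exists s, walk (0, 0)%R North (p ++ w) = walk (0, 0)%R North p ++ s.
  elim: p (0, 0)%R North => [|t p IHp] v d /=.
    case: w => [|t w]; first by exists [::].
    case: w => [|t' w] /=; first by exists [:: step (step v d) (turn t d)].
    by exists (walk (step (step v d) (turn t d)) (turn t' (turn t d)) w).
  by have [s ->] := IHp (step v d) (turn t d); exists s.
by rewrite /saw Es cat_uniq => /and3P[].
Qed.

Definition turns := [:: Some true; None; Some false].

(** Words grow at the front, so the turns that can close a short loop with a new letter form a
    prefix, which a trie can look up. *)
Fixpoint exts n (h : seq (option bool)) : seq (seq (option bool)) :=
  if n is n'.+1 then flatten [seq exts n' (t :: h) | t <- turns & saw (t :: h)]
  else [:: h].

Lemma mem_exts w h : saw (w ++ h) -> w ++ h \in exts (size w) h.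
Proof.
elim/last_ind: w h => [|w t IHw] h; first by rewrite mem_seq1.
rewrite size_rcons cat_rcons => sw; apply/flattenP.
exists (exts (size w) (t :: h)); last exact: IHw.
apply/mapP; exists t => //; rewrite mem_filter.
have -> : saw (t :: h) by elim: w sw {IHw} => // a w IHw /saw_cons.
by case: t {sw} => [[]|].
Qed.

Module Growth.

(* A trie of words with a weight at each node. The weights are certified to be
   contracting: extending a word at the front in all self-avoiding ways, and
   looking up the longest prefix that belongs to the trie, multiplies the weight
   by at most 19/7. *)
Inductive trie := L | T of BinNums.N & trie & trie & trie.
Notation E v := (T v L L L).

Definition child (l s r : trie) (t : option bool) :=
  match t with Some true => l | None => s | Some false => r end.

Fixpoint deepest (v0 : BinNums.N) tr (w : seq (option bool)) : BinNums.N :=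
  match tr with
  | L => v0
  | T v l s r => if w is t :: w' then deepest v (child l s r t) w' else v
  end.

Fixpoint value tr (w : seq (option bool)) : option BinNums.N :=
  match tr with
  | L => None
  | T v l s r => if w is t :: w' then value (child l s r t) w' else Some v
  end.

Lemma deepest_value v0 tr w : (if tr is L then False else True) ->
  exists p s, w = p ++ s /\ value tr p = Some (deepest v0 tr w).
Proof.
elim: w v0 tr => [|t w IHw] v0 [|v l s r] //= _; first by exists [::], [::].
case E: (child l s r t) => [|v' l' s' r'].
  by exists [::], (t :: w); case: w {IHw}.
have [//|p [q [-> Ep]]] := IHw v (T v' l' s' r').
by exists (t :: p), q; rewrite /= E.
Qed.

Definition contracts full w v :=
  (N.leb 1 v && N.leb
    (N.mul 7 (foldr (fun t x => N.add (if saw (t :: w) then deepest 0 full (t :: w) else 0%num) x)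
       0%num turns)) (N.mul 19 v))%num.

Fixpoint check full acc tr : bool :=
  match tr with
  | L => true
  | T v l s r => [&& contracts full (rev acc) v, check full (Some true :: acc) l,
      check full (None :: acc) s & check full (Some false :: acc) r]
  end.

Lemma checkP full acc tr w v :
  check full acc tr -> value tr w = Some v -> contracts full (rev acc ++ w) v.
Proof.
elim: w acc tr => [|t w IHw] acc [|v' l s r] //= /and4P[c0 cl cs cr].
  by case=> <-; rewrite cats0.
rewrite -cat_rcons -rev_cons; apply: IHw.
by case: t => [[]|].
Qed.

(** The weights form a supersolution. If [t :: h] is self-avoiding then so is [t :: p], and the
    deepest trie prefix of [t :: p] is again a prefix of [t :: h] with a known weight, so the
    induction on [n] runs over all [h] at once. *)
Lemma size_exts full n h p s v :
  check full [::] full -> h = p ++ s -> value full p = Some v ->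
  7 ^ n * size (exts n h) <= N.to_nat v * 19 ^ n.
Proof.
move=> chk; elim: n h p s v => [|n IHn] h p s v Eh Ev.
  have /andP[v1 _] := checkP chk Ev.
  by rewrite !expn0 /=; move/N.leb_spec0: v1; lia.
have /andP[_ /N.leb_spec0 c] := checkP chk Ev.
have -> : size (exts n.+1 h) =
    foldr (fun t x => (if saw (t :: h) then size (exts n (t :: h)) else 0) + x) 0 turns.
  rewrite /=; do 3 case: (saw _) => //=; by rewrite ?size_cat ?addn0 ?add0n.
have sub t : 7 ^ n * (if saw (t :: h) then size (exts n (t :: h)) else 0) <=
   N.to_nat (if saw (t :: p) then deepest 0 full (t :: p) else 0%num) * 19 ^ n.
  case: ifP => [st|_]; last by rewrite muln0.
  have -> : saw (t :: p) by apply: (@saw_prefix _ s); rewrite cat_cons -Eh.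
  have [|q [r [Eq Er]]] := @deepest_value 0%num full (t :: p).
    by case: (full) Ev.
  apply: (IHn _ q (r ++ s) _ _ Er).
  by rewrite catA -Eq Eh.
have h1 := sub (Some true); have h2 := sub None; have h3 := sub (Some false).
move: h1 h2 h3 c; rewrite /foldr /turns !expnS.
move: (if saw (Some true :: h) then _ else _) (if saw (None :: h) then _ else _)
  (if saw (Some false :: h) then _ else _) => a1 a2 a3.
rewrite [rev [::] ++ p]/=.
move: (if saw (Some true :: p) then _ else _) (if saw (None :: p) then _ else _)
  (if saw (Some false :: p) then _ else _) => b1 b2 b3.
move: (7 ^ n) (19 ^ n) => x y h1 h2 h3 c.
have {}c : 7 * (N.to_nat b1 + N.to_nat b2 + N.to_nat b3) <= 19 * N.to_nat v by lia.
apply: (@leq_trans (7 * ((N.to_nat b1 + N.to_nat b2 + N.to_nat b3) * y))); first by nia.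
by nia.
Qed.

Fixpoint mirror tr :=
  if tr is T v l s r then T v (mirror r) (mirror s) (mirror l) else L.

(** Reflection preserves self-avoidance, so at a node reached by straight moves only the left child
    is stored; the right one is its mirror image. *)
Fixpoint symmetric tr :=
  if tr is T v l s _ then T v l (symmetric s) (mirror l) else L.

(* Rounded Perron vector, up to reflection, of the walks that do not close a loop
   of length at most 12 (growth rate 2.7113), after pruning of the words that are
   not needed for the bound 19/7 < exp 1. *)
Definition weights : trie := symmetric
  (
(T 2001 (T 1764 (T 1260 L (T 1048 (T 565 L (T 388 (E 1) (T 316 (T 156 (E 1) (E
82) L) (T 287 (E 226) L L) L) (T 388 (T 357 (T 357 L (E 166) L) L L) L L)) (T
536 (T 466 (T 385 L (E 1) (T 327 (E 166) L L)) (T 411 (T 358 (E 358) (E 166)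
L) L L) L) (T 526 (T 503 (T 503 L (T 503 L (E 1) L) L) L L) L L) L)) (T 949 (T
740 (T 542 L L (T 398 (E 1) (T 327 (E 166) L L) L)) (T 608 (T 390 L (E 1) (T
327 (E 167) L L)) (T 521 (T 412 (E 412) (E 219) L) L L) L) (T 724 (T 678 (T
678 L (T 511 L (E 1) L) L) L L) L L)) (T 903 (T 817 (T 741 L (T 546 L L (T 546
(E 1) L L)) (T 625 (T 625 L (E 137) L) L L)) (T 735 (T 735 L (T 567 L (E 49)
L) L) L L) L) (T 892 (E 869) L L) L) (T 949 (T 938 (T 938 L (E 864) L) L L) L
L)) (T 1037 (T 1000 (T 970 L (T 781 (T 565 L L (T 402 (E 1) L L)) (T 624 (T
624 L (E 139) L) L L) L) (T 948 (E 885) L L)) (T 980 (T 960 (T 960 L L (E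
805)) (E 885) L) L L) L) (T 1034 (T 1025 (T 1025 L (T 1025 L (E 816) L) L) L
L) L L) L)) (T 1224 (T 1134 (T 1045 L (T 573 L (T 406 (E 1) (T 327 (E 166) L
L) L) (T 553 (T 490 (T 490 L (E 1) L) L L) L L)) (T 968 (T 778 (T 566 L L (T
406 (E 1) L L)) (T 628 (T 628 L (E 139) L) L L) L) (T 941 (E 878) L L) L)) (T
1069 (T 984 (T 984 L L (T 601 L (T 406 (E 1) L L) L)) (T 794 (T 577 L L (T 406
(E 1) L L)) (T 635 (T 497 L (E 1) L) L L) L) (T 961 (E 898) L L)) (T 1037 (T
995 (T 995 L (T 995 L L (E 601)) (E 840)) (T 920 (E 920) L L) L) L L) L) (T
1127 (T 1110 (T 1110 L (T 1044 (T 1044 L L (E 612)) (E 833) L) L) L L) L L))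
(T 1207 (T 1172 (T 1143 L (T 1067 L (T 621 L (T 407 (E 1) L L) L) (T 1067 (E
842) L L)) (T 1100 (T 1045 (T 1045 L L (E 621)) (E 842) L) L L)) (T 1141 (T
1141 (T 1141 L L (T 1141 L (E 621) L)) (T 1075 (T 1075 L L (E 621)) (E 861) L)
L) L L) L) (T 1203 (T 1195 (T 1195 L (T 1195 L (T 1195 L (E 624) L) L) L) L L)
L L) L) (T 1224 (T 1220 (T 1220 L (T 1193 (T 1193 L (T 1193 L (E 625) L) L) L
L) L) L L) (T 1220 L L (T 1220 L (T 1220 L (T 1143 L L (T 1143 L (E 599) L))
L) L)) L))) (T 1652 (T 1432 (T 1224 L L (T 1052 (T 573 L (T 402 (E 1) (T 325
(E 164) L L) L) (T 549 (T 486 (T 486 L (E 1) L) L L) L L)) (T 966 (T 776 (T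
563 L L (T 402 (E 1) L L)) (T 625 (T 625 L (E 139) L) L L) L) (T 939 (E 876) L
L) L) (T 1052 (T 1026 (T 1026 L (E 825) L) L L) L L))) (T 1276 (T 1044 L (T
572 L (T 404 (E 1) (T 325 (E 165) L L) L) (T 551 (T 488 (T 488 L (E 1) L) L L)
L L)) (T 966 (T 776 (T 564 L L (T 404 (E 1) L L)) (T 626 (T 489 L (E 1) L) L
L) L) (T 939 (E 877) L L) L)) (T 1184 (T 1032 (T 975 L L (T 593 L (T 404 (E 1)
L L) L)) (T 815 (T 598 L L (T 434 (E 31) L L)) (T 656 (T 518 L (E 31) L) L L)
L) (T 1010 (T 947 (E 947) L L) L L)) (T 1141 (T 1077 (T 1077 L (T 1077 L L (E
682)) (E 922)) (T 1002 (E 1002) L L) L) L L) L) (T 1270 (T 1241 (T 1241 L (T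
1105 (T 1105 L L (E 672)) (E 894) L) L) L L) L L)) (T 1406 (T 1346 (T 1287 L
(T 1069 L (T 621 L (T 406 (E 1) L L) L) (T 1013 (E 843) L L)) (T 1223 (T 1108
(T 1108 L L (E 682)) (E 904) L) L L)) (T 1295 (T 1257 (T 1257 L L (T 1257 L (E
752) L)) (T 1120 (T 1120 L L (E 682)) (E 904) L) L) L L) L) (T 1399 (T 1382 (T
1382 L (T 1382 L (T 1197 L (E 624) L) L) L) L L) L L) L)) (T 1598 (T 1495 (T
1414 L (T 1214 L L (T 1062 (T 606 L (T 405 (E 1) L L) L) (T 998 (E 828) L L)
L)) (T 1302 (T 1075 L (T 618 L (T 405 (E 1) L L) L) (T 1011 (E 840) L L)) (T
1224 (T 1111 (T 1111 L L (E 679)) (E 902) L) L L) L)) (T 1406 (T 1297 (T 1297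
L L (T 1153 L L (T 1153 (E 622) L L))) (T 1072 L (T 622 L (T 405 (E 1) L L) L)
(T 1015 (E 845) L L)) (T 1229 (T 1115 (T 1115 L L (E 684)) (E 910) L) L L)) (T
1342 (T 1283 (T 1283 L L (T 1283 L (E 774) L)) (T 1146 (T 1146 L L (E 703)) (E
929) L) L) L L) L) (T 1486 (T 1461 (T 1461 L (T 1399 L (T 1211 L (E 626) L) L)
L) L L) L L)) (T 1575 (T 1535 (T 1507 L (T 1435 L (T 1234 L L (T 1234 (E 628)
L L)) (T 1381 (T 1180 L (E 628) L) L L)) (T 1443 (T 1443 L (T 1263 L (E 678)
L) L) L L)) (T 1494 (T 1494 L (T 1432 L (T 1241 L (E 646) L) L) L) L L) L) (T
1571 (T 1563 (T 1563 L (E 1563) L) L L) L L) L) (T 1596 (T 1592 (T 1592 L (E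
1565) L) L L) L (T 1596 L (T 1596 L (T 1596 L (T 1519 L L (T 1519 L (E 970)
L)) L) L) L))) (T 1641 (T 1623 (T 1612 L (T 1524 (T 1444 L (T 1236 L L (T 1236
(E 624) L L)) (T 1326 (T 1178 L (E 625) L) L L)) (T 1438 (T 1438 L (T 1259 L
(E 675) L) L) L L) L) (T 1604 (E 1581) L L)) (T 1616 (T 1609 (T 1609 L L (E
1552)) (E 1581) L) L L) L) (T 1636 (T 1632 (T 1632 L (T 1632 L (E 1555) L) L)
L L) L (T 1636 L (T 1627 L (T 1598 L L (T 1598 L (T 1598 L (E 1016) L) L)) (T
1627 (T 1565 L L (T 1565 L (E 1016) L)) L L)) (T 1636 (T 1636 L (T 1565 L L (T
1565 L (E 1016) L)) L) L L))) (T 1637 (T 1631 L L (T 1624 L (T 1596 L L (T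
1596 L (T 1596 L (E 1017) L) L)) (T 1624 (T 1566 L L (T 1566 L (E 1017) L)) L
L))) (T 1627 (T 1627 L L (T 1596 L L (T 1596 L (T 1596 L (E 1017) L) L))) (T
1546 L (T 1489 L L (T 1434 L (E 1231) (T 1434 (E 1007) L L))) (T 1462 (T 1402
L L (E 1231)) (T 1007 L (T 796 L L (E 383)) L) L)) L) L))) (T 1728 (T 1684 (T
1643 L (T 1433 (T 1222 L L (T 1055 (T 594 L (T 392 (E 1) L L) L) (T 985 (E
815) L L) L)) (T 1291 (T 1057 L (T 605 L (T 392 (E 1) L L) L) (T 997 (E 826) L
L)) (T 1203 (T 1089 (T 1089 L L (E 666)) (E 887) L) L L) L) (T 1418 (T 1372 (T
1372 L (T 1192 L (E 616) L) L) L L) L L)) (T 1606 (T 1520 (T 1442 L (T 1234 L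
L (T 1083 (E 619) L L)) (T 1325 (T 1176 L (E 619) L) L L)) (T 1437 (T 1437 L
(T 1257 L (E 670) L) L) L L) L) (T 1596 (E 1573) L L) L)) (T 1653 (T 1616 (T
1616 L L (T 1475 (T 1254 L L (T 1083 (E 619) L L)) (T 1335 (T 1186 L (E 619)
L) L L) L)) (T 1528 (T 1448 L (T 1235 L L (T 1083 (E 619) L L)) (T 1325 (T
1176 L (E 619) L) L L)) (T 1440 (T 1389 L (T 1206 L (E 619) L) L) L L) L) (T
1608 (E 1585) L L)) (T 1641 (T 1626 (T 1626 L (T 1626 L L (E 1480)) (E 1568))
(T 1598 (E 1598) L L) L) L L) L) (T 1679 (T 1672 (T 1672 L (T 1648 (T 1648 L L
(E 1489)) (E 1570) L) L) L L) L (T 1679 L (T 1670 L (T 1641 L L (T 1641 L (T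
1641 L (E 1063) L) L)) (T 1670 (T 1611 L L (T 1611 L (E 1063) L)) L L)) L)))
(T 1708 (T 1693 (T 1683 L (T 1655 L (T 1465 (T 1237 L L (T 1074 (E 609) L L))
(T 1309 (T 1159 L (E 610) L) L L) L) (T 1655 (E 1572) L L)) (T 1667 (T 1647 (T
1647 L L (E 1490)) (E 1572) L) L L)) (T 1682 (T 1682 (T 1682 L L (T 1682 L (E
1490) L)) (T 1658 (T 1658 L L (E 1490)) (E 1579) L) L) L L) L) (T 1703 (T 1700
(T 1700 L (T 1700 L (T 1700 L (E 1489) L) L) L) L L) L (T 1697 L (T 1687 L L
(T 1687 L (T 1687 L (T 1687 L (E 1098) L) L) L)) (T 1697 (T 1676 L L (T 1676 L
(T 1676 L (E 1098) L) L)) (T 1697 (T 1643 L L (T 1643 L (E 1098) L)) L L) L)))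
(T 1694 (T 1691 L L (T 1683 L L (T 1683 L (T 1683 L (T 1683 L (E 1099) L) L)
L))) (T 1658 L (T 1625 L L (T 1606 L (T 1539 L (E 1323) (T 1539 (E 1095) L L))
(T 1606 (T 1606 L (E 1095) L) L L))) (T 1628 (T 1583 L L (T 1528 L (E 1323) (T
1528 (E 1095) L L))) (T 1550 (T 1494 L L (E 1323)) (T 1095 L (T 880 L L (E
445)) L) L) L)) (T 1694 (T 1634 L (T 1583 L L (T 1528 L (E 1319) (T 1528 (E
1091) L L))) (T 1553 (T 1490 L L (E 1319)) (T 1091 L (T 880 L L (E 445)) L)
L)) L L))) (T 1711 (T 1695 (T 1695 L (T 1685 (T 1685 L (T 1685 L (E 1476) L)
L) L L) L) (T 1692 L L (T 1683 L L (T 1683 L (T 1683 L (T 1683 L (E 1104) L)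
L) L))) (T 1661 L (T 1630 L L (T 1630 L (T 1564 L (E 1347) (T 1564 (E 1101) L
L)) (T 1630 (T 1630 L (E 1101) L) L L))) (T 1632 (T 1589 L L (T 1534 L (E
1329) (T 1534 (E 1101) L L))) (T 1555 (T 1500 L L (E 1329)) (T 1101 L (T 886 L
L (E 450)) L) L) L))) (T 1619 (T 1614 L L (T 1597 L L (T 1597 L (T 1531 L (E
1318) (T 1531 (E 1091) L L)) L))) (T 1556 L (T 1523 L L (T 1481 L (T 1407 L L
(E 1407)) (T 1481 (E 1325) (E 1481) L))) (T 1469 (T 1447 L L (T 1384 L L (E
1384))) (T 1279 L (T 1120 L L (T 976 L (E 450) L)) (T 1056 (T 885 L L (E 450))
L L)) (T 1469 (T 1080 L (T 885 L L (E 450)) L) L L))) (T 1531 (T 1453 L (T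
1427 L L (E 1365)) (T 1263 L (T 1114 L L (T 970 L (E 450) L)) (T 1045 (T 885 L
L (E 450)) L L))) (T 1052 (T 1052 L L (T 969 L L (T 969 L (E 450) L))) (T 856
L (T 778 L L (E 612)) (T 422 L (E 221) L)) L) L)) L))) (T 1901 (T 1799 (T 1709
L (T 1224 L (T 1019 (T 539 L (T 371 (E 1) (T 294 (E 142) L L) L) (T 517 (T 454
(T 454 L (E 1) L) L L) L L)) (T 926 (T 735 (T 529 L L (E 371)) (T 586 (T 586 L
(E 132) L) L L) L) (T 897 (E 834) L L) L) (T 1019 (T 989 (T 989 L (E 787) L) L
L) L L)) (T 1200 (T 1117 (T 1035 L (T 588 L (E 375) L) (T 976 (E 805) L L)) (T
1062 (T 1007 (T 1007 L L (E 588)) (E 805) L) L L) L) (T 1192 (T 1168 (T 1168 L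
(T 1168 L (E 600) L) L) L L) L L) L)) (T 1625 (T 1415 (T 1204 L L (T 1037 (T
577 L (E 375) L) (T 965 (E 794) L L) L)) (T 1271 (T 1039 L (T 589 L (T 376 (E
1) L L) L) (T 976 (E 805) L L)) (T 1184 (T 1070 (T 1070 L L (E 649)) (E 866)
L) L L) L) (T 1398 (T 1351 (T 1351 L (T 1172 L (E 599) L) L) L L) L L)) (T
1583 (T 1497 (T 1419 L (T 1211 L L (T 1211 (E 601) L L)) (T 1301 (T 1153 L (E
602) L) L L)) (T 1413 (T 1413 L (T 1234 L (E 653) L) L) L L) L) (T 1573 (E
1550) L L) L) (T 1625 (T 1616 (T 1616 L (E 1542) L) L L) L L))) (T 1726 (T
1626 (T 1626 L L (T 1221 L (T 1039 (T 577 L (E 375) L) (T 964 (E 794) L L) L)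
(T 1221 (T 1150 (T 1150 L (E 603) L) L L) L L))) (T 1415 (T 1204 L L (T 1036
(T 577 L (T 375 (E 1) L L) L) (T 964 (E 794) L L) L)) (T 1272 (T 1039 L (T 590
L (T 375 (E 1) L L) L) (T 977 (E 806) L L)) (T 1183 (T 1070 (T 1070 L L (E
650)) (E 867) L) L L) L) (T 1399 (T 1353 (T 1353 L (T 1174 L (E 600) L) L) L
L) L L)) (T 1588 (T 1502 (T 1424 L (T 1216 L L (T 1065 (E 603) L L)) (T 1307
(T 1158 L (E 604) L) L L)) (T 1419 (T 1369 L (T 1189 L (E 604) L) L) L L) L)
(T 1578 (E 1555) L L) L)) (T 1683 (T 1619 (T 1598 L (T 1598 L L (T 1239 L (T
1065 (E 603) L L) L)) (T 1458 (T 1239 L L (T 1065 (E 603) L L)) (T 1319 (T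
1171 L (E 604) L) L L) L)) (T 1521 (T 1441 L (T 1221 L L (T 1065 (E 603) L L))
(T 1320 (T 1172 L (E 615) L) L L)) (T 1433 (T 1382 L (T 1203 L (E 615) L) L) L
L) L) (T 1611 (T 1588 (E 1588) L L) L L)) (T 1668 (T 1644 (T 1644 L (T 1644 L
(E 1644) (E 1498)) (E 1587)) (T 1616 (E 1616) L L) L) L L) L) (T 1722 (T 1712
(T 1712 L (T 1661 (T 1661 L (E 1661) (E 1502)) (E 1584) L) L) L L) L (T 1722 L
(T 1722 L (T 1694 L L (T 1694 L (T 1694 L (E 1121) L) L)) L) L))) (T 1781 (T
1756 (T 1734 L (T 1645 (T 1645 L L (T 1252 L (T 1062 (E 599) L L) L)) (T 1455
(T 1226 L L (T 1062 (E 599) L L)) (T 1296 (T 1147 L (E 599) L) L L) L) (T 1625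
(E 1562) L L)) (T 1711 (T 1668 (T 1668 L (T 1668 L L (E 1260)) (E 1511)) (T
1593 (E 1593) L L) L) L L)) (T 1737 (T 1723 (T 1723 L L (T 1723 (T 1723 L L (E
1260)) (E 1537) L)) (T 1673 (T 1673 L (T 1673 L L (E 1260)) (E 1511)) (E 1593)
L) L) L L) L) (T 1776 (T 1770 (T 1770 L (T 1770 L (T 1702 (T 1702 L L (E
1261)) (E 1491) L) L) L) L L) L (T 1774 L (T 1763 L L (T 1763 L (T 1763 L (T
1763 L (E 1181) L) L) L)) (T 1774 (T 1753 L L (T 1753 L (T 1753 L (E 1181) L)
L)) L L))) (T 1777 (T 1774 L L (T 1766 L L (T 1766 L (T 1766 L (T 1766 L (E
1183) L) L) L))) (T 1741 L (T 1710 L L (T 1710 L (T 1644 L (E 1428) (T 1644 (E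
1180) L L)) (T 1710 (T 1710 L (E 1180) L) L L))) (T 1712 (T 1668 L L (T 1614 L
(E 1410) (T 1614 (E 1180) L L))) (T 1635 (T 1635 L L (E 1410)) (T 1180 L (T
967 L L (E 518)) L) L) L)) L))) (T 1854 (T 1810 (T 1776 L (T 1693 L (T 1218 L
(T 1022 (T 560 L (E 358) L) (T 944 (E 774) L L) L) (T 1218 (T 1136 (T 1136 L
(E 588) L) L L) L L)) (T 1630 (T 1434 (T 1211 L L (T 1051 (E 588) L L)) (T
1285 (T 1136 L (E 589) L) L L) L) (T 1606 (E 1543) L L) L)) (T 1727 (T 1643 (T
1643 L L (T 1247 L (T 1051 (E 588) L L) L)) (T 1450 (T 1222 L L (T 1051 (E
588) L L)) (T 1292 (T 1143 L (E 589) L) L L) L) (T 1619 (E 1556) L L)) (T 1698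
(T 1656 (T 1656 L (E 1656) (E 1497)) (E 1579) L) L L) L)) (T 1771 (T 1731 (T
1731 L L (T 1678 L (T 1253 L (T 1051 (E 588) L L) L) (T 1678 (E 1483) L L)))
(T 1640 (T 1640 L L (T 1245 L (T 1051 (E 588) L L) L)) (T 1448 (T 1219 L L (T
1051 (E 588) L L)) (T 1288 (T 1139 L (E 589) L) L L) L) (T 1619 (E 1557) L L))
(T 1706 (T 1664 (T 1664 L (T 1664 L L (E 1253)) (E 1505)) (E 1589) L) L L)) (T
1748 (T 1726 (T 1726 L (T 1726 L L (T 1726 L (E 1253) L)) (T 1726 (T 1726 L L
(E 1253)) (E 1539) L)) (T 1676 (T 1676 L (T 1676 L L (E 1253)) (E 1512)) (E
1596) L) L) L L) L) (T 1805 (T 1796 (T 1796 L (T 1773 (T 1773 L L (T 1773 L (E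
1258) L)) (T 1704 (T 1704 L L (E 1258)) (E 1488) L) L) L) L L) L (T 1805 L (T
1795 L L (T 1795 L (T 1795 L (T 1795 L (E 1218) L) L) L)) L))) (T 1836 (T 1820
(T 1810 L (T 1784 L (T 1710 L (T 1255 L (T 1043 (E 581) L L) L) (T 1710 (E
1486) L L)) (T 1764 (T 1690 (T 1690 L L (E 1255)) (E 1486) L) L L)) (T 1787 (T
1787 (T 1787 L L (T 1787 L (E 1255) L)) (T 1720 (T 1720 L L (E 1255)) (E 1505)
L) L) L L)) (T 1805 (T 1805 (T 1805 L L (T 1805 L (T 1805 L (E 1255) L) L)) (T
1783 (T 1783 L L (T 1783 L (E 1255) L)) (T 1712 (T 1712 L L (E 1255)) (E 1493)
L) L) L) L L) L) (T 1833 (T 1830 (T 1830 L (T 1830 L (T 1830 L (T 1830 L (E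
1255) L) L) L) L) L L) L L) L) L) L) L)  )%num.

Lemma check_weights : check weights [::] weights.
Proof. by vm_compute. Qed.

Lemma size_saw n : 7 ^ n * size (exts n [::]) <= 2001 * 19 ^ n.
Proof. exact: (@size_exts weights n [::] [::] [::] 2001%num check_weights). Qed.

End Growth.

(** * Contours *)

Definition dir_code d : bool * bool :=
  match d with
  | East => (true, true) | North => (true, false)
  | West => (false, true) | South => (false, false)
  end.

Definition dir_decode (c : bool * bool) :=
  match c with
  | (true, true) => East | (true, false) => North
  | (false, true) => West | (false, false) => South
  end.

Lemma dir_codeK : cancel dir_code dir_decode. Proof. by case. Qed.

HB.instance Definition _ := Equality.copy dir (can_type dir_codeK).

Definition opp d := lft (lft d).

(* The lattice point [v] is the upper right corner of the cell [v]; [lcell v d]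
   and [rcell v d] are the cells to the left and to the right of the unit edge
   that leaves [v] in direction [d]. *)
Definition lcell (v : int * int) d : int * int :=
  match d with
  | East => (v.1 + 1, v.2 + 1)%R
  | North => (v.1, v.2 + 1)%R
  | West => v
  | South => (v.1 + 1, v.2)%R
  end.

Definition rcell (v : int * int) d : int * int :=
  match d with
  | East => (v.1 + 1, v.2)%R
  | North => (v.1 + 1, v.2 + 1)%R
  | West => (v.1, v.2 + 1)%R
  | South => v
  end.

Lemma lcell_rev v d : lcell (step v d) (opp d) = rcell v d.
Proof. by case: v => a b; case: d => /=; congr (_, _); lia. Qed.

Lemma rcell_rev v d : rcell (step v d) (opp d) = lcell v d.
Proof. by case: v => a b; case: d => /=; congr (_, _); lia. Qed.

Lemma step_inj v : injective (step v).
Proof.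
by case: v => a b [] [] //= [] => *; exfalso; lia.
Qed.

Lemma nn_edge c c' : nn c c' -> exists v d, c = lcell v d /\ c' = rcell v d.
Proof.
case: c => i j; rewrite /nn /nbrs !inE => /or4P[] /eqP ->.
- by exists (i, j - 1)%R, North => /=; split; congr (_, _); lia.
- by exists (i - 1, j)%R, South => /=; split; congr (_, _); lia.
- by exists (i, j)%R, West.
- by exists (i - 1, j - 1)%R, East => /=; split; congr (_, _); lia.
Qed.

Lemma edge_nn v d : nn (lcell v d) (rcell v d).
Proof.
case: v => a b; rewrite /nn /nbrs; case: d; rewrite !inE /= !xpair_eqE.
- by apply/or4P/Or44; lia.
- by apply/or4P/Or41; lia.
- by apply/or4P/Or43; lia.
- by apply/or4P/Or42; lia.
Qed.

Lemma edge_inj v d v' d' :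
  lcell v d = lcell v' d' -> rcell v d = rcell v' d' -> v = v' /\ d = d'.
Proof.
by case: v v' => a b [a' b']; case: d; case: d' => /= -[? ?] [? ?];
  (split=> //; congr (_, _); lia) || (exfalso; lia).
Qed.

Lemma map_traject (A : Type) (f : A -> A) x n :
  [seq f v | v <- traject f x n] = traject f (f x) n.
Proof. by elim: n x => //= n IHn x; rewrite IHn. Qed.

Section Contour.
Variables (N : nat) (t : pred (int * int)).
Hypothesis t_box : forall c, t c -> box N c.

Definition bd v d := t (lcell v d) && ~~ t (rcell v d).

(** Two boundary edges leave a vertex where two diagonally opposite cells belong to [t] and the
    other two do not; [nxt] then picks one by a fixed order. Under the hypotheses of [cycle_covers]
    the outgoing edge turns out to be unique. *)
Definition nxt v := if bd v East then East else if bd v North then North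
  else if bd v West then West else South.

Definition follow v := step v (nxt v).

Lemma bd_nxt v d : bd v d -> bd v (nxt v).
Proof. by rewrite /nxt; case: ifP => // E; case: ifP => // F; case: ifP => // G; case: d; rewrite ?E ?F ?G. Qed.

(** Of the four cells around the head of the edge, two are known from [bd v d]. In each of the four
    cases for the two cells ahead, some boundary edge leaves the head, and it never reverses the
    given one. *)
Lemma bd_next v d : bd v d ->
  bd (step v d) (nxt (step v d)) /\ exists s, nxt (step v d) = turn s d.
Proof.
case: v => a b; rewrite /nxt /bd; case: d => /= /andP[E1 /negbTE E2];
  [ case E3: (t (a + 1 + 1, b + 1)%R); case E4: (t (a + 1 + 1, b)%R)
  | case E3: (t (a + 1, b + 1 + 1)%R); case E4: (t (a, b + 1 + 1)%R)
  | case E3: (t (a - 1, b + 1)%R); case E4: (t (a - 1, b)%R)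
  | case E3: (t (a + 1, b - 1)%R); case E4: (t (a, b - 1)%R) ];
  do 3 rewrite /= ?addrK ?subrK ?E1 ?E2 ?E3 ?E4; split => //;
  solve [by exists None | by exists (Some true) | by exists (Some false)].
Qed.

Section Winding.
Variable C : seq (int * int).
Hypotheses (C_uniq : uniq C) (C_bd : {in C, forall v, bd v (nxt v)})
  (C_follow : perm_eq [seq follow v | v <- C] C).

Definition flux v d : int := ((v \in C) && (nxt v == d))%:R%R.

(* The winding number of [C] around the cell [c], counted along the horizontal
   ray that leaves [c] to the right. *)
Definition winding (c : int * int) : int := (\sum_(v <- C)
  (([&& nxt v == North, v.2 == c.2 - 1 & c.1 <= v.1])%:R -
   ([&& nxt v == South, v.2 == c.2 & c.1 <= v.1])%:R))%R.

Lemma fluxE v d : flux v d = (\sum_(u <- C) ((u == v) && (nxt u == d))%:R)%R.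
Proof.
rewrite /flux; case: (boolP (v \in C)) => vC /=.
  rewrite (bigD1_seq v) //= eqxx /= big1_seq ?addr0 // => u /andP[/negbTE -> _].
  by [].
rewrite big1_seq // => u /= uC; case: eqP => // Euv.
by rewrite -Euv uC in vC.
Qed.

Lemma winding_hor i j : (winding (i, j) - winding (i + 1, j))%R =
  (flux (i, j - 1) North - flux (i, j) South)%R.
Proof.
rewrite /winding !fluxE -!sumrB; apply: eq_bigr => -[a b] _ /=.
rewrite !xpair_eqE; case: (nxt _) => /=; rewrite ?andbF ?andbT /= ?subr0 //.
  by case: (b == _) => /=; rewrite ?andbF ?andbT ?subr0 //; lia.
by case: (b == _) => /=; rewrite ?andbF ?andbT ?subr0 //; lia.
Qed.

Lemma winding_vert i j : (winding (i, j + 1) - winding (i, j))%R =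
  (flux (i - 1, j) East - flux (i, j) West)%R.
Proof.
(* [P] marks the lattice points of the ray between the two rows. Since [follow] permutes [C], as
   many steps enter this ray as leave it; adding this vanishing difference makes the identity hold
   term by term. *)
pose P (v : int * int) : int := ((v.2 == j) && (i <= v.1)%R)%:R%R.
have /eqP : (\sum_(v <- C) P (follow v) = \sum_(v <- C) P v)%R.
  by rewrite -(big_map follow predT P); apply: perm_big.
rewrite -subr_eq0 -sumrB => /eqP cyc.
rewrite /winding !fluxE -!sumrB -[LHS]addr0 -[X in (_ + X)%R = _]cyc -big_split /=.
apply: eq_bigr => -[a b] _ /=; rewrite /P /follow !xpair_eqE.
case: (nxt _) => /=; rewrite ?andbF ?andbT /= ?subr0 ?add0r //.
- by case: (b == j) => /=; rewrite ?andbF ?andbT ?subr0 //; lia.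
- have -> : (j + 1 - 1 = j)%R by lia.
  have -> : (b + 1 == j)%R = (b == j - 1)%R by lia.
  by case: (b == j); case: (b == j - 1)%R; case: (i <= a)%R.
- by case: (b == j) => /=; rewrite ?andbF ?andbT ?subr0 //; lia.
- have -> : (b - 1 == j)%R = (b == j + 1)%R by lia.
  by case: (b == j); case: (b == j + 1)%R; case: (i <= a)%R.
Qed.

Lemma winding_jump v d : (winding (lcell v d) - winding (rcell v d))%R =
  (flux v d - flux (step v d) (opp d))%R.
Proof.
case: v => a b; case: d => /=.
- by rewrite winding_vert addrK.
- by rewrite winding_hor addrK.
- by rewrite -opprB winding_vert opprB.
- by rewrite -opprB winding_hor opprB.
Qed.

Lemma flux_bd v d : flux v d != 0%R -> bd v d.
Proof. by rewrite /flux; case: andP => // -[vC /eqP <-] _; apply: C_bd. Qed.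

Lemma winding_nn c c' : nn c c' -> t c = t c' -> winding c = winding c'.
Proof.
move=> /nn_edge[v [d [-> ->]]] tE; apply/eqP; rewrite -subr_eq0 winding_jump.
have -> : flux v d = 0%R.
  by apply/eqP; apply: contraT => /flux_bd; rewrite /bd tE; case: (t _).
have -> : flux (step v d) (opp d) = 0%R; last by rewrite subrr.
apply/eqP; apply: contraT => /flux_bd.
by rewrite /bd lcell_rev rcell_rev tE; case: (t _).
Qed.

Lemma winding_outside c : ~~ box N c -> winding c = 0%R.
Proof.
have zero i j : (j < 1)%R || (N%:Z < j)%R || (N%:Z < i)%R -> winding (i, j) = 0%R.
  move=> ij; rewrite /winding big1_seq // => -[a b] /= /C_bd; rewrite /bd.
  case: (nxt _) => /= /andP[/t_box]; rewrite /box /= ?subrr //; lia.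
(* To the left of the box the ray can meet the contour. The cell is moved down its column, which
   avoids [t], to a row below the box. *)
have left i j : (i < 1)%R -> winding (i, j) = 0%R.
  move=> i1; have [j1|j1] := lerP 1 j; last by apply: zero; rewrite j1.
  have <- : (`|j|%N%:Z = j)%R by lia.
  elim: `|j|%N => [|n IHn]; first exact: zero.
  rewrite -IHn; apply: winding_nn.
    by rewrite /nn /nbrs !inE /= !xpair_eqE; apply/or4P/Or44; lia.
  have F k : t (i, k) = false by apply/negP => /t_box; rewrite /box /=; lia.
  by rewrite !F.
case: c => i j; rewrite /box /= => cN.
have [i1|i1] := ltP i 1%R; first exact: left.
by apply: zero; lia.
Qed.

End Winding.

(* Connectedness of [t] and of its complement, in the form in which it is applied
   to winding numbers. *)
Hypothesis t_conn : forall f : int * int -> int,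
  (forall c c', nn c c' -> t c = t c' -> f c = f c') ->
  (forall c, ~~ box N c -> f c = 0%R) ->
  (forall c, ~~ t c -> f c = 0%R) /\ (forall c c', t c -> t c' -> f c = f c').

(* The winding number of [C] is constant on [t] and vanishes off [t], so it jumps
   by the same amount along the whole boundary. *)
Lemma cycle_covers (C : seq (int * int)) v0 : uniq C ->
  {in C, forall v, bd v (nxt v)} -> perm_eq [seq follow v | v <- C] C ->
  v0 \in C -> forall v d, bd v d -> v \in C /\ nxt v = d.
Proof.
move=> Cu Cb Cf v0C v d vd.
have [w0 w1] := t_conn (winding_nn Cu Cb Cf) (winding_outside Cu Cb Cf).
have jump u e : bd u e -> winding C (lcell u e) = flux C u e.
  move=> ue; have := winding_jump Cu Cf u e; have /andP[_ r] := ue.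
  rewrite (w0 _ r) subr0 => ->.
  have -> : flux C (step u e) (opp e) = 0%R; last by rewrite subr0.
  apply/eqP; apply: contraT => /(flux_bd Cb).
  by rewrite /bd lcell_rev (negbTE r).
have b0 := Cb _ v0C.
have := jump _ _ vd; have := jump _ _ b0.
rewrite (w1 (lcell v d) (lcell v0 (nxt v0))); last 2 first.
  by case/andP: vd.
  by case/andP: b0.
move=> ->; rewrite /flux v0C eqxx /=.
by case: andP => // -[vC /eqP dE].
Qed.

Lemma bd_range v d : bd v d -> (0 <= v.1 <= N%:Z)%R /\ (0 <= v.2 <= N%:Z)%R.
Proof.
by case: v => a b; rewrite /bd; case: d => /= /andP[/t_box]; rewrite /box /=; lia.
Qed.

(** The orbit of [follow] stays in a finite grid and runs into a cycle. By [cycle_covers] this cycle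
    uses every boundary edge, in particular the starting one, so the orbit has no transient part. *)
Lemma contour_cycle v0 d0 : bd v0 d0 -> exists n, [/\ (1 < n)%N,
  uniq (traject follow v0 n), iter n follow v0 = v0 &
  forall v d, bd v d <-> v \in traject follow v0 n /\ nxt v = d].
Proof.
move=> b0.
have out k : bd (iter k follow v0) (nxt (iter k follow v0)).
  elim: k => [|k IHk]; first exact: bd_nxt b0.
  by rewrite iterS; case: (bd_next IHk).
pose grid := [seq ((a : nat)%:Z, (b : nat)%:Z)%R | a <- iota 0 N.+1, b <- iota 0 N.+1].
have sub n : {subset traject follow v0 n <= grid}.
  move=> v /trajectP[k _ ->]; have := bd_range (out k).
  case: (iter k follow v0) => a b /= [a1 b1].
  apply/allpairsP; exists (`|a|%N, `|b|%N).
  by rewrite !mem_iota /=; split; try lia; congr (_, _); lia.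
have lp : exists n, looping follow v0 n.
  exists (size grid); apply: contraT; rewrite -looping_uniq => u.
  by have := uniq_leq_size u (sub _); rewrite size_traject ltnn.
case: (ex_minnP lp) => -[//|n] ln min_n.
have u : uniq (traject follow v0 n.+1).
  by rewrite looping_uniq; apply/negP => /min_n; rewrite ltnn.
have /trajectP[i lt_in Ei] := ln.
pose C := drop i (traject follow v0 n.+1).
have Cu : uniq C by apply: drop_uniq.
have EC : C = traject follow (iter i follow v0) (n.+1 - i).
  have E : traject follow v0 n.+1 =
      traject follow v0 i ++ traject follow (iter i follow v0) (n.+1 - i).
    by rewrite -trajectD subnKC // ltnW.
  by rewrite /C E drop_size_cat ?size_traject.
have Cb : {in C, forall v, bd v (nxt v)}.
  by move=> v; rewrite EC => /trajectP[k _ ->]; rewrite -iterD.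
have Cf : perm_eq [seq follow v | v <- C] C.
  rewrite EC map_traject -(perm_cons (iter i follow v0)) -trajectS trajectSr.
  have -> : iter (n.+1 - i) follow (iter i follow v0) = iter i follow v0.
    by rewrite -iterD subnK // ltnW.
  by rewrite perm_rcons.
have zC : iter i follow v0 \in C.
  by rewrite EC; apply/trajectP; exists 0%N => //; lia.
have all_C := cycle_covers Cu Cb Cf zC.
have i0 : i = 0%N.
  have [v0C _] := all_C _ _ b0; apply/eqP; apply: contraLR u; rewrite -lt0n => i_gt0.
  rewrite -(cat_take_drop i (traject _ _ _)) cat_uniq negb_and negb_and negbK.
  apply/orP; right; apply/orP; left; apply/hasP; exists v0 => //=.
  by case: (i) i_gt0 => // k _; rewrite /= inE eqxx.
have CE : C = traject follow v0 n.+1 by rewrite /C i0 drop0.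
exists n.+1; split => //.
- case: (n) CE Ei; rewrite ?i0 //= => _ /esym; rewrite /follow.
  by case: (v0) => a b; case: (nxt _) => //= -[]; lia.
- by rewrite Ei i0.
- rewrite -CE => v d; split; first exact: all_C.
  by case=> vC <-; apply: Cb.
Qed.

Lemma traject_walk m v : bd v (nxt v) ->
  exists2 w, size w = m & walk v (nxt v) w = traject follow v m.+2.
Proof.
elim: m v => [|m IHm] v vb; first by exists [::].
have [b' [s Es]] := bd_next vb.
have [w sw Ew] := IHm _ b'.
by exists (s :: w); rewrite /= ?sw // -Es Ew.
Qed.

(** The first direction is given and the last edge closes the path, so a contour with [n] edges is a
    word of [n - 2] turns. Its edges are the cyclically consecutive pairs of vertices, hence
    [rot 1]. *)
Lemma contour_word v0 d0 : bd v0 d0 -> exists w, [/\ saw w,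
  forall v d, bd v d <->
    (v, step v d) \in zip (walk v0 d0 w) (rot 1 (walk v0 d0 w)) &
  exists C, [/\ uniq C, size C = (size w).+2 &
    forall v d, bd v d <-> v \in C /\ nxt v = d]].
Proof.
move=> b0; have [n [n1 u per all_C]] := contour_cycle b0.
case: n n1 u per all_C => [|[|n]] // _ u per all_C.
have [_ d0E] := (all_C _ _).1 b0; rewrite -d0E in b0 *.
have [w sw Ew] := traject_walk n b0.
exists w; rewrite -(uniq_walk v0 (nxt v0)) Ew; split => //; last first.
  by exists (traject follow v0 n.+2); rewrite size_traject sw.
have -> : rot 1 (traject follow v0 n.+2) = [seq follow v | v <- traject follow v0 n.+2].
  rewrite map_traject [RHS]trajectSr -iterSr per.
  by rewrite [traject follow v0 n.+2]/= rot1_cons.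
move=> v d; rewrite all_C -[X in zip X]map_id zip_map.
split=> [[vC <-]|/mapP[u' u'C [-> /step_inj ->]]]; last by split.
by apply/mapP; exists v.
Qed.

End Contour.

(** A row is scanned from beyond the right side of the box, where both sets are empty; the vertical
    boundary edges tell where membership changes. *)
Lemma bd_determines N (t t' : pred (int * int)) :
  (forall c, t c -> box N c) -> (forall c, t' c -> box N c) ->
  (forall v d, bd t v d <-> bd t' v d) -> t =1 t'.
Proof.
move=> tb tb' E [i j].
have far (s : pred (int * int)) (sb : forall c, s c -> box N c) k : (N%:Z < k)%R -> s (k, j) = false.
  by move=> ?; apply/negP => /sb; rewrite /box /=; lia.
have [lt|le] := ltP (N%:Z)%R i; first by rewrite !far.
pose k := absz (N%:Z + 1 - i)%R.
have -> : (i = N%:Z + 1 - k%:Z)%R by rewrite /k; lia.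
elim: k => [|n IHn]; first by rewrite !far //; lia.
set i' := (N%:Z + 1 - n.+1%:Z)%R.
have i'E : (i' + 1 = N%:Z + 1 - n%:Z)%R by rewrite /i'; lia.
rewrite -{}i'E in IHn.
have := E (i', j - 1)%R North; have := E (i', j) South.
rewrite /bd /= subrK IHn.
by case: (t (i', j)) (t' (i', j)) (t' (i' + 1, j)%R) => [] [] [] //= [h1 h2] [h3 h4];
  solve [by have := h1 isT | by have := h2 isT | by have := h3 isT | by have := h4 isT].
Qed.

(** * Sets of sites, their perimeters and the counting of contours *)

Section Sites.
Variable N : nat.
Implicit Types (x y : site N) (T S : {set site N}).

Lemma pt_inj : injective (@pt N).
Proof. by move=> [i j] [i' j'] [] /val_inj -> /val_inj ->. Qed.

Lemma box_pt x : box N (pt x).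
Proof. by case: x => [[i Hi] [j Hj]]; rewrite /box /pt /=; lia. Qed.

Lemma boxP c : reflect (exists x : site N, pt x = c) (box N c).
Proof.
apply: (iffP idP) => [|[x <-]]; last exact: box_pt.
case: c => i j; rewrite /box /= => ij.
have Hi : (`|i|%N.-1 < N)%N by lia.
have Hj : (`|j|%N.-1 < N)%N by lia.
by exists (Ordinal Hi, Ordinal Hj); rewrite /pt /=; congr (_, _); lia.
Qed.

Definition ind T : pred (int * int) := fun c => [exists x in T, pt x == c].

Lemma ind_pt T x : ind T (pt x) = (x \in T).
Proof.
apply/exists_inP/idP => [[y yT /eqP/pt_inj <- //]|xT]; by exists x.
Qed.

Lemma ind_box T c : ind T c -> box N c.
Proof. by case/exists_inP => x _ /eqP <-; apply: box_pt. Qed.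

Lemma indP T c : ind T c -> exists2 x, x \in T & pt x = c.
Proof. by case/exists_inP => x xT /eqP; exists x. Qed.

Definition perim T : nat :=
  (\sum_(x in T) \sum_(c <- nbrs (pt x)) (~~ ind T c : nat))%N.

Lemma nn_sym c c' : nn c c' = nn c' c.
Proof.
case: c c' => a b [a' b']; rewrite /nn /nbrs !inE /= !xpair_eqE.
by apply/idP/idP => /or4P[] /andP[/eqP-> /eqP->];
  rewrite ?addrK ?subrK !eqxx ?orbT.
Qed.

Lemma nbrs_uniq c : uniq (nbrs c).
Proof. by case: c => a b; rewrite /= !inE /= !xpair_eqE; lia. Qed.

Definition adjo (u v : option (site N)) : bool :=
  match u, v with
  | Some x, Some y => nn (pt x) (pt y)
  | Some x, None | None, Some x => ~~ all (box N) (nbrs (pt x))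
  | None, None => false
  end.

Lemma adjo_sym u v : adjo u v = adjo v u.
Proof. by case: u v => [x|] [y|] //=; apply: nn_sym. Qed.

Definition within T x y := [&& x \in T, y \in T & nn (pt x) (pt y)].

(* [None] stands for the complement of the box. *)
Definition off T (u : option (site N)) : bool := if u is Some x then x \notin T else true.

(** Connected sets without holes; the boundary of such a set is a single closed curve. *)
Definition admissible T := [&& T != finset.set0,
  [forall x in T, forall y in T, connect (within T) x y] &
  [forall u, off T u ==>
     connect (fun u v => [&& off T u, off T v & adjo u v]) None u]].

Lemma connect_invariant (I : finType) (A : Type) (e : rel I) (f : I -> A) a b :
  (forall u v, e u v -> f u = f v) -> connect e a b -> f a = f b.
Proof.
move=> inv /connectP[p]; elim: p a => [|z p IHp] a /=; first by move=> _ ->.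
by case/andP => /inv -> ? ?; apply: IHp.
Qed.

Lemma admissible_conn T : admissible T -> forall f : int * int -> int,
  (forall c c', nn c c' -> ind T c = ind T c' -> f c = f c') ->
  (forall c, ~~ box N c -> f c = 0%R) ->
  (forall c, ~~ ind T c -> f c = 0%R) /\
  (forall c c', ind T c -> ind T c' -> f c = f c').
Proof.
case/and3P => _ /forall_inP Tconn /forallP Tco f inv out; split; last first.
  move=> _ _ /indP[x xT <-] /indP[y yT <-].
  apply: (connect_invariant (f := fun x => f (pt x))) (forall_inP (Tconn x xT) y yT).
  by move=> u v /and3P[uT vT uv]; apply: inv => //; rewrite !ind_pt uT vT.
move=> c; have [/boxP[x <-]|cb _] := boolP (box N c); last exact: out.
rewrite ind_pt => xT; have /implyP/(_ xT) co := Tco (Some x).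
pose F (u : option (site N)) := if u is Some x then f (pt x) else 0%R.
symmetry; apply: (connect_invariant (f := F)) co.
have bdry z : z \notin T -> ~~ all (box N) (nbrs (pt z)) -> f (pt z) = 0%R.
  move=> zT /allPn[c' c'n c'b]; rewrite -(out _ c'b); apply: inv => //.
  rewrite ind_pt (negbTE zT); symmetry; apply/negbTE.
  by apply: contra c'b; apply: ind_box.
case=> [u|] [v|] /and3P[] //= uT vT uv.
- by apply: inv => //; rewrite !ind_pt (negbTE uT) (negbTE vT).
- exact: bdry.
- by rewrite bdry.
Qed.

Lemma perim_directions T : perim T =
  (#|[set x in T | ~~ ind T ((pt x).1 + 1, (pt x).2)%R]| +
   #|[set x in T | ~~ ind T ((pt x).1 - 1, (pt x).2)%R]| +
   #|[set x in T | ~~ ind T ((pt x).1, (pt x).2 + 1)%R]| +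
   #|[set x in T | ~~ ind T ((pt x).1, (pt x).2 - 1)%R]|)%N.
Proof.
rewrite /perim /nbrs; under eq_bigr do rewrite !big_cons big_nil addn0.
rewrite !big_split /= !addnA -!sum1_card.
by do ![congr (_ + _)%N]; rewrite [RHS]big_mkcond [LHS]big_mkcond /=;
  apply: eq_bigr => x _; rewrite inE; case: (x \in T); case: (ind _ _).
Qed.

(** In each line that meets [T] the last site in the direction of [sh] is an exit. Here [key] names
    the line and [g] orders its sites. *)
Lemma leq_card_exits (key : site N -> 'I_N) (g : site N -> nat)
    (sh : int * int -> int * int) T :
  (forall x y, sh (pt x) = pt y -> key y = key x /\ (g x < g y)%N) ->
  (#|key @: T| <= #|[set x in T | ~~ ind T (sh (pt x))]|)%N.
Proof.
move=> Hsh; apply: leq_trans (leq_imset_card key _); apply: subset_leq_card.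
apply/fintype.subsetP => _ /imsetP[x xT ->].
pose P := [pred y | (y \in T) && (key y == key x)].
have Px : P x by rewrite /= xT eqxx.
case: (arg_maxnP g Px) => y /andP[yT kyx] ymax; rewrite -(eqP kyx).
apply/imsetP; exists y => //; rewrite inE yT /=; apply/negP => /indP[z zT Ez].
have [kz gz] := Hsh _ _ (esym Ez).
have /ymax : P z by rewrite inE zT kz kyx.
by rewrite /geq /= leqNgt gz.
Qed.



(** Each row and each column that meets [T] is left at both of its ends. *)
Lemma perim_ge T : (2 * (#|fst @: T| + #|snd @: T|) <= perim T)%N.
Proof.
have E := @leq_card_exits snd (fun x => x.1) (fun c => (c.1 + 1, c.2)%R) T.
have W := @leq_card_exits snd (fun x => N - x.1)%N (fun c => (c.1 - 1, c.2)%R) T.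
have No := @leq_card_exits fst (fun x => x.2) (fun c => (c.1, c.2 + 1)%R) T.
have So := @leq_card_exits fst (fun x => N - x.2)%N (fun c => (c.1, c.2 - 1)%R) T.
have {}E : (#|snd @: T| <= #|[set x in T | ~~ ind T ((pt x).1 + 1, (pt x).2)%R]|)%N.
  by apply: E => -[[a Ha] [b Hb]] [[a' Ha'] [b' Hb']] /= [e1 e2]; split; [apply: val_inj => /=|]; lia.
have {}W : (#|snd @: T| <= #|[set x in T | ~~ ind T ((pt x).1 - 1, (pt x).2)%R]|)%N.
  by apply: W => -[[a Ha] [b Hb]] [[a' Ha'] [b' Hb']] /= [e1 e2]; split; [apply: val_inj => /=|]; lia.
have {}No : (#|fst @: T| <= #|[set x in T | ~~ ind T ((pt x).1, (pt x).2 + 1)%R]|)%N.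
  by apply: No => -[[a Ha] [b Hb]] [[a' Ha'] [b' Hb']] /= [e1 e2]; split; [apply: val_inj => /=|]; lia.
have {}So : (#|fst @: T| <= #|[set x in T | ~~ ind T ((pt x).1, (pt x).2 - 1)%R]|)%N.
  by apply: So => -[[a Ha] [b Hb]] [[a' Ha'] [b' Hb']] /= [e1 e2]; split; [apply: val_inj => /=|]; lia.
rewrite perim_directions mul2n -addnn; lia.
Qed.

Lemma card_le_proj T : (#|T| <= #|fst @: T| * #|snd @: T|)%N.
Proof.
rewrite -cardsX; apply: subset_leq_card; apply/fintype.subsetP => -[a b] xT.
by rewrite inE; apply/andP; split; apply/imsetP; exists (a, b).
Qed.

Lemma card_proj_gt0 T x : x \in T -> (0 < #|fst @: T|)%N /\ (0 < #|snd @: T|)%N.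
Proof.
by move=> xT; split; apply/card_gt0P; [exists x.1|exists x.2]; apply/imsetP; exists x.
Qed.

Lemma perim_ge4 T x : x \in T -> (4 <= perim T)%N.
Proof. by move=> /card_proj_gt0[? ?]; have := perim_ge T; lia. Qed.

Lemma perim_ge6 T : (1 < #|T|)%N -> (6 <= perim T)%N.
Proof. by have := perim_ge T; have := card_le_proj T; nia. Qed.

(** This turns errors of order [1 / N] per site of [T] into a small multiple of the perimeter. *)
Lemma card_le_perim T : (#|T| <= N * perim T)%N.
Proof.
have := perim_ge T; have := card_le_proj T.
have : (#|fst @: T| <= N)%N by rewrite -[X in (_ <= X)%N](card_ord N) max_card.
by nia.
Qed.

Lemma card_le_perim2 T : (#|T| <= perim T ^ 2)%N.
Proof. by have := perim_ge T; have := card_le_proj T; nia. Qed.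

Lemma perim_le T : (perim T <= 4 * N ^ 2)%N.
Proof.
apply: (@leq_trans (\sum_(x in T) 4)%N).
  apply: leq_sum => x _; rewrite /nbrs !big_cons big_nil.
  by do 4 case: (ind _ _).
rewrite sum_nat_const mulnC leq_mul2l /= -mulnn.
by apply: leq_trans (max_card _) _; rewrite card_prod card_ord.
Qed.

Lemma size_contour T (C : seq (int * int)) : uniq C ->
  (forall v d, bd (ind T) v d <-> v \in C /\ nxt (ind T) v = d) -> perim T = size C.
Proof.
move=> Cu HC.
pose P := [seq (pt x, c) | x <- enum T, c <- [seq c <- nbrs (pt x) | ~~ ind T c]].
have -> : perim T = size P.
  rewrite size_allpairs_dep sumnE big_map big_enum; apply: eq_bigr => x _.
  by rewrite size_filter -sum1_count [RHS]big_mkcond; apply: eq_bigr => c _; case: (ind _ _).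
pose e v := (lcell v (nxt (ind T) v), rcell v (nxt (ind T) v)).
rewrite -(size_map e); apply/perm_size/uniq_perm.
- apply: allpairs_uniq_dep => [|x _|[x c] [x' c'] _ _ eq_p].
  + exact: enum_uniq.
  + by rewrite filter_uniq ?nbrs_uniq.
  + have /= := congr1 snd eq_p; have /= /pt_inj -> := congr1 fst eq_p.
    by move=> ->.
- rewrite map_inj_in_uniq // => v v' _ _ [l r].
  by have [] := edge_inj l r.
move=> [c c']; apply/allpairsPdep/mapP.
  move=> [x [c'' [xT]]]; rewrite mem_filter => /andP[nT xc] [-> ->].
  have [v [d [El Er]]] := nn_edge xc.
  have /HC[vC dE] : bd (ind T) v d.
    by rewrite /bd -El -Er ind_pt nT andbT -mem_enum.
  by exists v; rewrite // /e dE -El -Er.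
move=> [v vC [-> ->]]; set d := nxt _ v.
have /andP[/indP[x xT Ex] nT] : bd (ind T) v d by apply/HC.
exists x, (rcell v d); rewrite mem_enum mem_filter nT Ex; split => //.
exact: edge_nn.
Qed.

(** The lower right corner of the cell [k] places to the right of [y]; the edge that leaves it to
    the North has that cell on its left. *)
Definition start (y : site N) (k : nat) : int * int := ((pt y).1 + k%:Z, (pt y).2 - 1)%R.

(** Moving right from [y], one leaves [T] across a boundary edge oriented North, where the contour
    is made to start. The [k + 1] sites passed have distinct first coordinates, so [perim_ge] bounds
    [k]. *)
Lemma admissible_word T y : admissible T -> y \in T -> exists k w,
  [/\ (k < perim T)%N, saw w, perim T = (size w).+2 &
  forall v d, bd (ind T) v d <->
    (v, step v d) \in zip (walk (start y k) North w) (rot 1 (walk (start y k) North w))].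
Proof.
move=> aT yT; pose right k := ((pt y).1 + k%:Z, (pt y).2)%R.
have leave : exists k, ~~ ind T (right k).
  exists N; apply/negP => /ind_box; have := box_pt y; rewrite /box /right /=; lia.
case: (ex_minnP leave) => -[|k] out_k min_k.
  by move: out_k; rewrite /right addr0 -surjective_pairing ind_pt yT.
have in_k j : (j <= k)%N -> ind T (right j).
  by move=> jk; apply: contraT => /min_k; rewrite ltnNge jk.
have b0 : bd (ind T) (start y k) North.
  rewrite /bd /start /lcell /rcell subrK; apply/andP; split; first exact: in_k.
  have E : right k.+1 = ((pt y).1 + k%:Z + 1, (pt y).2)%R.
    by rewrite /right; congr (_, _); lia.
  by rewrite E in out_k; exact: out_k.
have [w [sw Ew [C [Cu sC HC]]]] := contour_word (@ind_box T) (admissible_conn aT) b0.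
exists k, w; split => //; last by rewrite (size_contour Cu HC).
suff : (k < #|fst @: T|)%N by have := perim_ge T; lia.
have ltN j : (j <= k)%N -> (y.1 + j < N)%N.
  by move=> /in_k/ind_box; rewrite /box /right /=; lia.
pose f (j : 'I_k.+1) := Ordinal (ltN j (ltn_ord j)).
have f_inj : injective f.
  by move=> j j' /(congr1 val) /= /addnI /val_inj.
rewrite -[X in (X <= _)%N](card_ord k.+1) -(card_codom f_inj).
apply: subset_leq_card; apply/fintype.subsetP => _ /codomP[j ->].
have /indP[x xT Ex] := in_k j (ltn_ord j).
apply/imsetP; exists x => //; apply: val_inj => /=.
by move/(congr1 fst): Ex; rewrite /pt /right /=; lia.
Qed.

(** A set is determined by its boundary edges, hence by the offset [k] and the word. The index
    [n.-2] comes from [perim T = (size w).+2]. *)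
Lemma card_admissible y n :
  (#|[set T : {set site N} | [&& admissible T, y \in T & perim T == n]]| <=
   n * size (exts n.-2 [::]))%N.
Proof.
set A := finset _.
have /choice[code Hcode] (T : {set site N}) : exists c : nat * seq (option bool),
    T \in A -> c \in [seq (k, w) | k <- iota 0 n, w <- exts n.-2 [::]] /\
    forall v d, bd (ind T) v d <-> (v, step v d) \in
      zip (walk (start y c.1) North c.2) (rot 1 (walk (start y c.1) North c.2)).
  have [|_] := boolP (T \in A); last by exists (0%N, [::]).
  rewrite inE => /and3P[aT yT /eqP nT].
  have [k [w [kn sw nw HT]]] := admissible_word aT yT.
  exists (k, w) => _; split => //.
  apply/allpairsP; exists (k, w); split; rewrite //= ?mem_iota; first lia.
  have -> : n.-2 = size w by lia.
  by have := @mem_exts w [::]; rewrite cats0; apply.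
have u : uniq [seq code T | T <- enum A].
  rewrite map_inj_in_uniq ?enum_uniq // => T T'.
  rewrite !mem_enum => /Hcode[_ HT] /Hcode[_ HT'] E.
  apply/setP => x; rewrite -!ind_pt.
  apply: (bd_determines (@ind_box T) (@ind_box T')) => v d.
  by rewrite HT HT' E.
have sub : {subset [seq code T | T <- enum A] <=
    [seq (k, w) | k <- iota 0 n, w <- exts n.-2 [::]]}.
  by move=> c /mapP[T]; rewrite mem_enum => /Hcode[cT _] ->.
have := uniq_leq_size u sub.
by rewrite size_map -cardE size_allpairs size_iota.
Qed.

End Sites.

Local Open Scope ring_scope.

(** * Exponential sums over contours around a point *)

Section Counting.
Variable R : realType.

(** This rational lies above the growth bound 19/7, which leaves room for a rate [c < 1] in
    [peierls_sum]. *)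
Lemma expR1_gt : 679 / 250 < expR 1 :> R.
Proof.
have nd : {homo (series (exp_coeff (1 : R))) : n m / (n <= m)%N >-> n <= m}.
  by apply/nondecreasing_seqP => n; rewrite /series /= big_nat_recr //= lerDl exp_coeff_ge0.
have := nondecreasing_cvgn_le nd (is_cvg_series_exp_coeff 1) 8%N.
rewrite -[limn _]/(expR 1); apply: lt_le_trans.
rewrite /series /exp_coeff /= !big_cons big_nil !expr1n !factS fact0.
by lra.
Qed.

Lemma sum_natmul_geom (r : R) n : 0 <= r < 1 ->
  \sum_(i < n) i%:R * r ^+ i <= (1 - r)^-2.
Proof.
move=> /andP[r0 r1].
have E : (1 - r) ^+ 2 * (\sum_(i < n) i%:R * r ^+ i) =
         r - r ^+ n * (n%:R * (1 - r) + r).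
  elim: n => [|n IHn]; first by rewrite big_ord0 expr0; ring.
  by rewrite big_ord_recr mulrDr IHn /= [r ^+ n.+1]exprS -natr1; ring.
rewrite -[leRHS]mul1r ler_pdivlMr ?exprn_gt0 ?subr_gt0 // mulrC E.
apply: (@le_trans _ _ r); last exact: ltW.
rewrite gerBl mulr_ge0 ?exprn_ge0 // addr_ge0 // mulr_ge0 //; lra.
Qed.

Lemma peierls_sum : exists c G : R, [/\ 0 < c, c < 1, 1 <= G &
  forall N (y : site N),
    \sum_(T : {set site N} | admissible T && (y \in T)) expR (- (c * (perim T)%:R)) <= G].
Proof.
(* The rate [c = ln q] is below 1 because [q < expR 1]. The ratio [r] of the growth bound to [q] is
   below 1 as well, so the sum over perimeters is dominated by that of [n r ^ n]. *)
pose q : R := 679 / 250; pose r : R := 19 / 7 / q.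
have q1 : 1 < q by rewrite /q; lra.
have r01 : 0 <= r < 1 by rewrite /r /q; lra.
have [K KE] : exists K : R, K = 2001 by exists 2001.
have K1 : 1 <= K by rewrite KE ler1n.
have K0 : 0 <= K by apply: le_trans K1.
exists (ln q), (K * (1 - r)^-2); split.
- by rewrite ln_gt0.
- by rewrite -[ltRHS](@expRK R) ltr_ln ?posrE ?expR_gt0 ?expR1_gt //; lra.
- have : 1 <= (1 - r)^-2.
    by rewrite invf_ge1 ?exprn_gt0 ?exprn_ile1; lra.
  exact: mulr_ege1.
move=> N y.
have Eq n : expR (- (ln q * n%:R)) = q ^- n.
  by rewrite expRN mulrC expRM_natl lnK // posrE; lra.
pose M := (4 * N ^ 2).+1.
rewrite (partition_big (fun T => inord (perim T) : 'I_M) predT) //=.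
apply: le_trans (_ : \sum_(n < M) K * (n%:R * r ^+ n) <= _); last first.
  by rewrite -mulr_sumr ler_wpM2l // sum_natmul_geom.
apply: ler_sum => n _.
have E (T : {set site N}) : (inord (perim T) == n :> 'I_M) = (perim T == n :> nat).
  by rewrite -val_eqE /= inordK // ltnS; apply: perim_le.
under eq_bigl do rewrite E.
rewrite (eq_bigr (fun=> q ^- n)) => [|T /andP[_ /eqP ->]]; last exact: Eq.
rewrite sumr_const -[leLHS]mulr_natl.
have Ec := card_admissible y n.
rewrite (@eq_card _ _ [set T : {set site N} | [&& admissible T, y \in T & perim T == n]]); last first.
  by move=> T; rewrite inE unfold_in andbA.
have [n2|n2] := ltnP n 2.
  have -> : #|[set T : {set site N} | [&& admissible T, y \in T & perim T == n]]| = 0%N.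
    apply/eqP; rewrite cards_eq0; apply/eqP/setP => T; rewrite !inE.
    by apply/and3P => -[_ /perim_ge4 T4 /eqP Tn]; rewrite -Tn ltnNge (leq_trans _ T4) in n2.
  by rewrite mul0r !mulr_ge0 ?exprn_ge0 //; case/andP: r01.
apply: (@le_trans _ _ ((n * size (exts n.-2 [::]))%:R * q ^- n)).
  by rewrite ler_wpM2r ?invr_ge0 ?exprn_ge0 ?ler_nat //; lra.
have sz : (size (exts n.-2 [::]))%:R <= K * (19 / 7) ^+ n.
  apply: (@le_trans _ _ (K * (19 / 7) ^+ n.-2)); last first.
    rewrite ler_wpM2l // ler_weXn2l ?leq_sub2l //; last by rewrite -subn2 leq_subr.
    by lra.
  rewrite expr_div_n mulrA ler_pdivlMr ?exprn_gt0 // mulrC.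
  by rewrite KE -!natrX -!natrM ler_nat Growth.size_saw.
apply: le_trans (_ : n%:R * (K * (19 / 7) ^+ n) * q ^- n <= _).
  by rewrite natrM ler_wpM2r ?invr_ge0 ?exprn_ge0 ?ler_wpM2l // ltW // (lt_trans _ q1).
by rewrite /r [(_ / q) ^+ n]expr_div_n mulrCA !mulrA.
Qed.

End Counting.

(* [B ^- min(#|S|, M)] is superharmonic for the recursion: small sets have little
   weight on proper supersets because of [B], large ones because [perim] is large.
   The rate is that of the smallest perimeter [p], up to one factor [exp beta]. *)
Lemma superharmonic_chain (R : realType) (c G : R) : 0 < c -> c < 1 -> 1 <= G ->
  exists A : R, 1 <= A /\
  forall (beta b : R) (p s N : nat) (y : site N) (u : nat -> {set site N} -> R) (W : R),
  1 <= beta -> b <= beta -> beta - b <= 100^-1 -> beta - b <= (1 - c) / 2 ->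
  (0 < p <= 6)%N ->
  (forall T : {set site N}, y \in T -> s <= #|T| -> p <= perim T)%N ->
  \sum_(T : {set site N} | admissible T && (y \in T)) expR (- (c * (perim T)%:R)) <= G ->
  0 <= W -> (forall S, u 0%N S <= W) ->
  (forall r (S : {set site N}), admissible S -> y \in S -> u r.+1 S <=
     \sum_(T : {set site N} | admissible T && (S \subset T)) expR (- (b * (perim T)%:R)) * u r T) ->
  forall r (S : {set site N}), admissible S -> y \in S -> (s <= #|S|)%N ->
  u r S <= A * expR (- ((p.-1)%:R * beta * r%:R)) * W.
Proof.
move=> c0 c1 G1.
(* [G] offsets the sum over supersets and [expR 6] offsets [expR (c * p)], as [p <= 6] and
   [c < 1]. *)
pose B := G * expR 6.
have B1 : 1 <= B by rewrite -[1]mulr1 ler_pM // -expR0 ler_expR.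
have B0 : 0 < B by apply: lt_le_trans B1.
(* Sets with at least [M = n0 ^ 2] sites have perimeter at least [n0]; this is large enough for
   [exp (- (b - c) n0)] to beat [G exp (5 beta)]. *)
pose n0 := (Num.trunc (2 * (5 + ln G) / (1 - c))).+1.
have n0P : 5 + ln G <= (1 - c) / 2 * n0%:R.
  have : 2 * (5 + ln G) / (1 - c) < n0%:R by apply: truncnS_gt.
  rewrite ltr_pdivrMr; lra.
pose M := (n0 ^ 2)%N.
exists (B ^+ M); split; first exact: exprn_ege1.
move=> beta b p s N y u W beta1 bb b1 b2 /andP[p0 p6] Hp HG W0 u0 uS.
pose Phi (S : {set site N}) := B ^- minn #|S| M.
have Phi0 S : 0 < Phi S by rewrite invr_gt0 exprn_gt0.
have p6R : p%:R <= 6 :> R by rewrite (ler_nat R _ 6).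
have bc : (1 - c) / 2 * beta <= b - c by nra.
have bc0 : 0 <= b - c by nra.
pose E : R := expR (- ((p.-1)%:R * beta)).
have wE n : expR (- (b * n%:R)) = expR (- (c * n%:R)) * expR (- ((b - c) * n%:R)).
  by rewrite -expRD; congr expR; ring.
have mass (S : {set site N}) (P : pred {set site N}) (k : R) : y \in S -> 0 <= k ->
    (forall T, P T -> S \subset T -> expR (- ((b - c) * (perim T)%:R)) * Phi T <= k) ->
    \sum_(T : {set site N} | admissible T && (S \subset T) && P T)
       expR (- (b * (perim T)%:R)) * Phi T <= G * k.
  move=> yS k0 HP.
  apply: le_trans (_ : \sum_(T : {set site N} | admissible T && (y \in T))
    expR (- (c * (perim T)%:R)) * k <= _); last by rewrite -mulr_suml ler_wpM2r.
  rewrite [leLHS]big_mkcond [leRHS]big_mkcond; apply: ler_sum => T _.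
  have [aT|_] //= := boolP (admissible T).
  have [ST|_] /= := boolP (S \subset T); last first.
    by case: ifP => // _; rewrite mulr_ge0 ?expR_ge0.
  rewrite (fintype.subsetP ST _ yS); case: ifP => [PT|_]; last by rewrite mulr_ge0 ?expR_ge0.
  by rewrite wE -mulrA ler_wpM2l ?expR_ge0 ?HP.
have sub_le (S T : {set site N}) : S \subset T -> Phi T <= Phi S.
  move=> ST; rewrite lef_pV2 ?posrE ?exprn_gt0 // ler_weXn2l ?leq_min //.
  by rewrite geq_minr andbT geq_min subset_leq_card.
have step (S : {set site N}) : admissible S -> y \in S -> (s <= #|S|)%N ->
    \sum_(T : {set site N} | admissible T && (S \subset T))
      expR (- (b * (perim T)%:R)) * Phi T <= E * Phi S.
  move=> aS yS sS.
  have [MS|MS] := leqP M #|S|.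
    have := @mass S predT (expR (- ((b - c) * n0%:R)) * Phi S) yS.
    under eq_bigl do rewrite andbT.
    move=> /(_ _ _)/le_trans; apply.
    - by rewrite mulr_ge0 ?expR_ge0 // ltW.
    - move=> T _ ST; rewrite ler_pM ?expR_ge0 ?sub_le ?(ltW (Phi0 T)) // ler_expR lerN2.
      rewrite ler_wpM2l // ler_nat leqNgt; apply/negP => Tn.
      have : (#|T| < M)%N by apply: leq_ltn_trans (card_le_perim2 T) _; rewrite ltn_sqr.
      by rewrite ltnNge (leq_trans MS (subset_leq_card ST)).
    rewrite mulrA ler_wpM2r ?(ltW (Phi0 S)) // -[G]lnK ?posrE; last by lra.
    rewrite -expRD ler_expR.
    have h1 : (p.-1)%:R * beta <= 5 * beta.
      by rewrite ler_wpM2r ?(le_trans ler01) // (ler_nat R _ 5) -ltnS prednK.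
    have h2 : ln G <= ln G * beta by rewrite ler_peMr // ln_ge0.
    have h3 : (1 - c) / 2 * beta * n0%:R <= (b - c) * n0%:R by rewrite ler_wpM2r.
    have h4 : (5 + ln G) * beta <= (1 - c) / 2 * n0%:R * beta.
      by rewrite ler_wpM2r // (le_trans ler01).
    rewrite mulrAC in h4; clear -h1 h2 h3 h4; lra.
  (* The term [T = S] is set apart; since [#|S| < M], every proper superset gains a factor
     [1 / B]. *)
  rewrite (bigD1 S) /=; last by rewrite aS subxx.
  have pS : p%:R <= (perim S)%:R :> R by rewrite ler_nat Hp.
  have b_ge0 : 0 <= b by nra.
  have first_le : expR (- (b * (perim S)%:R)) <= expR (- (b * p%:R)).
    by rewrite ler_expR lerN2 ler_wpM2l.
  have := @mass S (fun T => T != S) (expR (- ((b - c) * p%:R)) * (Phi S / B)) yS.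
  move=> /(_ _ _)/(lerD (lexx (expR (- (b * (perim S)%:R)) * Phi S)))/le_trans; apply.
  - by rewrite mulr_ge0 ?expR_ge0 // divr_ge0 ?ltW.
  - move=> T nTS ST; rewrite ler_pM ?expR_ge0 ?(ltW (Phi0 T)) //.
      rewrite ler_expR lerN2 ler_wpM2l // ler_nat Hp ?(fintype.subsetP ST) //.
      exact: leq_trans (subset_leq_card ST).
    have ltST : (#|S| < #|T|)%N by apply: proper_card; rewrite finset.properEneq eq_sym nTS.
    rewrite -invfM -exprSr lef_pV2 ?posrE ?exprn_gt0 // ler_weXn2l //.
    by rewrite leq_min !(leq_ltn_trans (geq_minl _ _)).
  have -> : G * (expR (- ((b - c) * p%:R)) * (Phi S / B)) =
            expR (- (b * p%:R)) * (expR (c * p%:R) * expR (- 6)) * Phi S.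
    have -> : expR (- (b * p%:R)) = expR (- ((b - c) * p%:R)) * expR (- (c * p%:R)).
      by rewrite -expRD; congr expR; ring.
    rewrite /B (expRN 6) (expRN (c * p%:R)); field.
    by rewrite !gt_eqF ?expR_gt0 // (lt_le_trans ltr01).
  have ec : expR (c * p%:R) * expR (- 6) <= 1.
    rewrite -expRD -[leRHS]expR0 ler_expR.
    have : c * p%:R <= p%:R by rewrite ler_piMl // ltW.
    by clear -p6R; lra.
  rewrite -mulrDl ler_wpM2r ?(ltW (Phi0 S)) //.
  (* Both contributions are at most [exp (- b p)]. The resulting factor 2 is paid by the single
     [exp beta] that the rate concedes, as [beta - (beta - b) p >= 94 / 100]. *)
  have two : 2 <= expR (b * p%:R - (p.-1)%:R * beta).
    have le94 : 94 / 100 <= b * p%:R - (p.-1)%:R * beta.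
      have -> : (p.-1)%:R = p%:R - 1 :> R by rewrite -[X in X%:R - 1](prednK p0) -natr1 addrK.
      have : (beta - b) * p%:R <= 100^-1 * 6 by rewrite ler_pM // subr_ge0.
      by clear -beta1; lra.
    apply: le_trans (_ : expR (94 / 100) <= _); last by rewrite ler_expR.
    have -> : 94 / 100 = 1 + - (6 / 100) :> R by lra.
    rewrite expRD; have := expR1_gt R; have := expR_ge1Dx (- (6 / 100) : R).
    by nra.
  apply: (@le_trans _ _ (2 * expR (- (b * p%:R)))).
    have := expR_gt0 (- (b * p%:R)); nra.
  rewrite -ler_pdivlMr ?expR_gt0 // -expRN -expRD opprK addrC.
  exact: two.
have pos_rhs r : 0 <= B ^+ M * E ^+ r * W.
  by rewrite !mulr_ge0 ?exprn_ge0 ?expR_ge0 ?(ltW B0).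
have main : forall r (S : {set site N}), admissible S -> y \in S -> (s <= #|S|)%N ->
    u r S <= B ^+ M * E ^+ r * W * Phi S.
  elim=> [|r IHr] S aS yS sS.
    apply: le_trans (u0 S) _; rewrite expr0 mulr1 mulrAC -[leLHS]mul1r ler_wpM2r //.
    rewrite -ler_pdivrMl ?exprn_gt0 // mulr1 lef_pV2 ?posrE ?exprn_gt0 //.
    by rewrite ler_weXn2l // geq_minr.
  apply: le_trans (uS r S aS yS) _.
  apply: le_trans (_ : \sum_(T : {set site N} | admissible T && (S \subset T))
     (B ^+ M * E ^+ r * W) * (expR (- (b * (perim T)%:R)) * Phi T) <= _).
    apply: ler_sum => T /andP[aT ST]; rewrite mulrCA ler_wpM2l ?expR_ge0 //.
    rewrite IHr ?(fintype.subsetP ST) //.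
    exact: leq_trans (subset_leq_card ST).
  rewrite -mulr_sumr exprSr.
  have swap (a e w x : R) : a * (E ^+ r * e) * w * x = a * E ^+ r * w * (e * x) by ring.
  rewrite swap.
  by rewrite ler_wpM2l ?step.
move=> r S aS yS sS; apply: le_trans (main r S aS yS sS) _.
have -> : expR (- ((p.-1)%:R * beta * r%:R)) = E ^+ r.
  by rewrite /E -expRM_natl; congr expR; ring.
rewrite ler_piMr // invf_le1 ?exprn_gt0 //.
exact: exprn_ege1.
Qed.

(** * Sums over surfaces *)

Local Open Scope classical_set_scope.

Section Mass.
Variables (R : realType) (T : choiceType).
Implicit Types (w : T -> R) (A B : set T).

Lemma esumZl (A : set T) (f : T -> \bar R) (c : R) : 0 <= c ->
  (forall i, 0 <= f i)%E -> \esum_(i in A) (c%:E * f i)%E = (c%:E * \esum_(i in A) f i)%E.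
Proof.
move=> c0 f0; rewrite /esum -ereal_supZl //; last first.
  by apply/set0P; exists (\sum_(x \in (set0 : set T)) f x)%E, set0 => //; split.
congr ereal_sup; rewrite image_comp; apply: eq_imagel => X [Xfin _] /=.
by rewrite ge0_mule_fsumr.
Qed.

Definition summable_weight w := (forall x, 0 <= w x) /\
  (\esum_(x in [set: T]) (w x)%:E < +oo)%E.

(** [fine] sends an infinite sum to 0, so the value is meaningful only for a [summable_weight]. *)
Definition mass w A : R := fine (\esum_(x in A) (w x)%:E).

Lemma esum_sub (f : T -> \bar R) A B : (forall x, 0 <= f x)%E -> A `<=` B ->
  (\esum_(x in A) f x <= \esum_(x in B) f x)%E.
Proof.
move=> f0 AB; rewrite esum_mkcond [leRHS]esum_mkcond; apply: le_esum => x _.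
case: ifPn => [/set_mem/AB/mem_set -> //|_]; by case: ifPn.
Qed.

Lemma massE w A : summable_weight w -> (mass w A)%:E = \esum_(x in A) (w x)%:E.
Proof.
move=> [w0 wfin]; rewrite /mass fineK // ge0_fin_numE; last first.
  by apply: esum_ge0 => x _; rewrite lee_fin.
by apply: le_lt_trans wfin; apply: esum_sub => // x; rewrite lee_fin.
Qed.

Lemma mass_ge0 w A : summable_weight w -> 0 <= mass w A.
Proof.
by move=> [w0 _]; apply: fine_ge0; apply: esum_ge0 => x _; rewrite lee_fin.
Qed.

Lemma mass_sub w A B : summable_weight w -> A `<=` B -> mass w A <= mass w B.
Proof.
move=> sw AB; rewrite -lee_fin !massE //; apply: esum_sub => // x.
by rewrite lee_fin; case: sw.
Qed.

Lemma massID w A B : summable_weight w ->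
  mass w A = mass w (A `&` B) + mass w (A `&` ~` B).
Proof.
move=> sw; apply: EFin_inj; rewrite EFinD !massE // -esumID // => x _.
by rewrite lee_fin; case: sw.
Qed.

Lemma mass_cover (I : finType) w A (P : pred I) (B : I -> set T) :
  summable_weight w ->
  (forall x, A x -> exists2 i, P i & B i x) ->
  mass w A <= \sum_(i | P i) mass w (B i).
Proof.
move=> sw AB; have [w0 _] := sw.
rewrite -lee_fin -sumEFin massE //; under eq_bigr do rewrite massE //.
under eq_bigr do rewrite esum_mkcond.
rewrite -esum_sum; last by move=> x i _ _; case: ifP => //; rewrite lee_fin.
rewrite esum_mkcond; apply: le_esum => x _.
case: ifPn => [/set_mem/AB[i Pi /mem_set Bi]|_].
  rewrite (bigD1 i) //= Bi leeDl // sume_ge0 // => j _.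
  by case: ifP => //; rewrite lee_fin.
by apply: sume_ge0 => j _; case: ifP => //; rewrite lee_fin.
Qed.

(* [x] is replaced by the family of all [F x i] with [J x i]; injectivity makes
   the contributions of distinct pairs [(x, i)] add up. *)
Lemma mass_map (I : choiceType) (r : seq I) w w' A A' (J : T -> pred I) (F : T -> I -> T) (c : R) :
  uniq r -> summable_weight w -> summable_weight w' ->
  (forall x i, A x -> J x i -> A' (F x i)) ->
  (forall x i y j, A x -> J x i -> A y -> J y j -> F x i = F y j -> x = y /\ i = j) ->
  0 <= c -> (forall x, A x -> c * w x <= \sum_(i <- r | J x i) w' (F x i)) ->
  c * mass w A <= mass w' A'.
Proof.
move=> ur sw sw' FA Finj c0 Hc; have [w0 _] := sw; have [w'0 _] := sw'.
rewrite -lee_fin EFinM !massE // -esumZl //.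
pose D x : set I := [set i | (i \in r) && J x i].
apply: (@le_trans _ _ (\esum_(x in A) \esum_(i in D x) (w' (F x i))%:E)%E).
  apply: le_esum => x Ax; rewrite -EFinM.
  apply: (@le_trans _ _ (\sum_(i <- r | J x i) w' (F x i))%:E); first by rewrite lee_fin Hc.
  rewrite -sumEFin esum_fset; last 2 first.
  - by apply: sub_finite_set (finite_seq r) => i /= /andP[].
  - by move=> i _; rewrite lee_fin.
  rewrite -big_filter fsbig_finite /=; last first.
    by apply: sub_finite_set (finite_seq r) => i /= /andP[].
  rewrite le_eqVlt; apply/orP; left; apply/eqP; apply: perm_big.
  apply: uniq_perm; rewrite ?filter_uniq ?fset_uniq // => i.
  rewrite mem_filter in_fset_set; last first.
    by apply: sub_finite_set (finite_seq r) => k /= /andP[].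
  apply/andP/idP => [[? ?]|/set_mem/andP[] //]; apply/mem_set/andP; by split.
rewrite esum_esum; last by move=> x i _ _; rewrite lee_fin.
rewrite -(@esum_image _ _ _ _ (fun k : T * I => F k.1 k.2) (fun z => (w' z)%:E)).
  apply: esum_sub => [z|z]; first by rewrite lee_fin.
  by move=> [[x i] /= [Ax /andP[_ Jxi]] <-]; apply: FA.
move=> [x i] [y j] /set_mem[/= Ax /andP[_ Ji]] /set_mem[/= Ay /andP[_ Jj]] /(Finj _ _ _ _ Ax Ji Ay Jj)[-> ->].
by [].
Qed.

Lemma mass_map1 w w' A A' (F : T -> T) (c : R) :
  summable_weight w -> summable_weight w' ->
  (forall x, A x -> A' (F x)) -> (forall x y, A x -> A y -> F x = F y -> x = y) ->
  0 <= c -> (forall x, A x -> c * w x <= w' (F x)) ->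
  c * mass w A <= mass w' A'.
Proof.
move=> sw sw' FA Finj c0 Hc.
apply: (@mass_map _ [:: tt] w w' A A' (fun _ => predT) (fun x _ => F x)) => //.
- by move=> x i Ax _; apply: FA.
- by move=> x i y j Ax _ Ay _ /(Finj _ _ Ax Ay) ->; split=> //; case: i j => -[].
- by move=> x Ax; rewrite big_seq1 /= Hc.
Qed.

Lemma mass_le w w' A (c : R) : summable_weight w -> summable_weight w' -> 0 <= c ->
  (forall x, A x -> c * w x <= w' x) -> c * mass w A <= mass w' A.
Proof. by move=> sw sw' c0 H; apply: (@mass_map1 w w' A A id). Qed.

Lemma mass_sum (I : finType) (B : I -> set T) w : summable_weight w ->
  summable_weight (fun x => w x * (\sum_i (x \in B i)%:R)) ->
  mass (fun x => w x * (\sum_i (x \in B i)%:R)) setT = \sum_i mass w (B i).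
Proof.
move=> sw sw'; apply: EFin_inj; rewrite massE // -sumEFin.
under [RHS]eq_bigr do rewrite massE // esum_mkcond.
rewrite -esum_sum; last first.
  by move=> x i _ _; case: ifP => //; rewrite lee_fin; case: sw.
apply: eq_esum => x _; rewrite mulr_sumr -sumEFin; apply: eq_bigr => i _.
by case: ifP; rewrite ?mulr1 ?mulr0.
Qed.

Lemma summable_le w w' (c : R) : summable_weight w -> 0 <= c ->
  (forall x, 0 <= w' x <= c * w x) -> summable_weight w'.
Proof.
move=> sw c0 H; split=> [x|]; first by case/andP: (H x).
apply: (@le_lt_trans _ _ (\esum_(x in [set: T]) (c%:E * (w x)%:E)%E)).
  by apply: le_esum => x _; rewrite -EFinM lee_fin; case/andP: (H x).
rewrite esumZl //; first by rewrite -massE // -EFinM ltry.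
by move=> x; rewrite lee_fin; case: sw.
Qed.

Lemma massZ w (c : R) A : 0 <= c -> summable_weight w ->
  mass (fun x => c * w x) A = c * mass w A.
Proof.
move=> c0 sw; have [w0 _] := sw.
have sc : summable_weight (fun x => c * w x).
  by apply: (summable_le sw c0) => x; rewrite mulr_ge0 ?lexx.
apply: EFin_inj; rewrite EFinM (massE _ sc) (massE _ sw).
by rewrite -esumZl // => x; rewrite lee_fin.
Qed.

Lemma summableD w w' : summable_weight w -> summable_weight w' ->
  summable_weight (fun x => w x + w' x).
Proof.
move=> sw sw'; have [w0 wf] := sw; have [w0' wf'] := sw'.
split=> [x|]; first exact: addr_ge0.
under eq_esum do rewrite EFinD.
by rewrite esumD ?lte_add_pinfty // => x _; rewrite lee_fin.
Qed.

Lemma massD w w' A : summable_weight w -> summable_weight w' ->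
  mass (fun x => w x + w' x) A = mass w A + mass w' A.
Proof.
move=> sw sw'; have [w0 wf] := sw; have [w0' wf'] := sw'.
apply: EFin_inj; rewrite EFinD !massE //; last exact: summableD.
under eq_esum do rewrite EFinD.
by rewrite esumD // => x _; rewrite lee_fin.
Qed.

End Mass.

Section Energy.
Variables (R : realType) (N : nat).
Implicit Types (phi psi : surface N).

Definition hgt phi (c : int * int) : nat :=
  if [pick x : site N | pt x == c] is Some x then phi x else 0%N.

Lemma hgt_pt phi x : hgt phi (pt x) = phi x.
Proof.
rewrite /hgt; case: pickP => [y /eqP/pt_inj -> //|/(_ x)]; by rewrite eqxx.
Qed.

Lemma hgt_out phi c : ~~ box N c -> hgt phi c = 0%N.
Proof.
by rewrite /hgt; case: pickP => // x /eqP <-; rewrite box_pt.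
Qed.

(** With truncated subtraction an edge contributes only when seen from its higher end, so each one
    counts once and the Hamiltonian becomes a natural number. *)
Definition energy phi : nat :=
  (\sum_(x : site N) \sum_(c <- nbrs (pt x)) (phi x - hgt phi c))%N.

Lemma sum_nbrs (F : int * int -> nat) (x : site N) :
  (\sum_(c <- nbrs (pt x) | box N c) F c = \sum_(y : site N | nn (pt x) (pt y)) F (pt y))%N.
Proof.
rewrite -big_filter -[RHS]big_enum -(big_map (@pt N) predT F).
apply: perm_big; apply: uniq_perm.
- by rewrite filter_uniq // nbrs_uniq.
- by rewrite map_inj_uniq ?enum_uniq //; apply: pt_inj.
move=> c; rewrite mem_filter; apply/andP/mapP => [[/boxP[y <-] xy]|[y]].
  by exists y => //; rewrite mem_enum.
by rewrite mem_enum => xy ->; rewrite box_pt.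
Qed.

Lemma hamiltonianE phi : hamiltonian R phi = (energy phi)%:R.
Proof.
have bdryE (x : site N) : {in nbrs (pt x), forall c, bdry N c = ~~ box N c}.
  move=> c xc; rewrite /bdry; case: (box N c); first by [].
  rewrite andTb; apply/hasP.
  have xn : nn c (pt x) by rewrite nn_sym.
  by exists (pt x); last exact: box_pt.
pose D := (\sum_(x : site N) \sum_(y : site N | nn (pt x) (pt y)) (phi x - phi y))%N.
have -> : energy phi = (D + \sum_(x : site N) \sum_(c <- nbrs (pt x) | ~~ box N c) phi x)%N.
  rewrite -big_split; apply: eq_bigr => x _ /=.
  rewrite (bigID (box N)) /=; congr (_ + _)%N.
    by rewrite sum_nbrs; apply: eq_bigr => y _; rewrite hgt_pt.
  by apply: eq_bigr => c cb; rewrite hgt_out // subn0.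
rewrite /hamiltonian natrD; congr (_ + _); last first.
  rewrite natr_sum; apply: eq_bigr => x _; rewrite natr_sum.
  rewrite [LHS]big_seq_cond [RHS]big_seq_cond; apply: eq_big => c.
    by apply: andb_id2l => xc; rewrite (bdryE x).
  by rewrite ger0_norm.
have -> : \sum_(x : site N) \sum_(y : site N | nn (pt x) (pt y))
    `|(phi x)%:R - (phi y)%:R| = (D + D)%:R :> R.
  have D2 : D = (\sum_(x : site N) \sum_(y : site N | nn (pt x) (pt y)) (phi y - phi x))%N.
    rewrite /D (exchange_big_dep predT) //=; apply: eq_bigr => x _.
    by apply: eq_bigl => y; rewrite nn_sym.
  rewrite {2}D2 /D -big_split natr_sum; apply: eq_bigr => x _ /=.
  rewrite -big_split natr_sum; apply: eq_bigr => y _ /=.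
  have [le|le] := leqP (phi x) (phi y).
    by rewrite distrC ger0_norm ?subr_ge0 ?ler_nat // -natrB // (eqP le).
  rewrite ger0_norm ?subr_ge0 ?ler_nat ?(ltnW le) // -natrB ?(ltnW le) //.
  by have /eqP -> := ltnW le; rewrite addn0.
by rewrite addnn -mul2n natrM mulrA mulVf // mul1r.
Qed.

Lemma zeros_preim phi : preim_level phi (pred1 (0 : int)) = [set x | phi x == 0%N]%SET.
Proof. by apply/setP => x; rewrite !inE /=; case: (phi x). Qed.

Definition zeros phi : {set site N} := [set x | phi x == 0%N]%SET.

Lemma weightE beta h phi : weight beta h phi =
  expR (- beta * (energy phi)%:R + h * #|zeros phi|%:R) :> R.
Proof. by rewrite /weight hamiltonianE zeros_preim. Qed.

(** If the partition function is infinite, its inverse is 0 and so is every probability. Otherwise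
    the weights are summable and the normalization can be multiplied out. *)
Lemma sos_prob_le (beta h q : R) (A : set (surface N)) : 0 <= q ->
  (summable_weight (@weight R N beta h) ->
   mass (@weight R N beta h) A <= q * mass (@weight R N beta h) setT) ->
  (sos_prob beta h A <= q%:E)%E.
Proof.
move=> q0 H; rewrite /sos_prob /sos_mass.
have w0 phi : 0 <= weight beta h phi :> R by apply: expR_ge0.
have [Zfin|Zinf] := ltP (partition_function N beta h) +oo%E; last first.
  rewrite esum1 ?lee_fin // => phi _.
  have -> : partition_function N beta h = +oo%E by apply/eqP; rewrite -leye_eq.
  by rewrite invey mule0.
have sw : summable_weight (@weight R N beta h) by split.
have {H} := H sw; set z := mass _ setT => H.
have ZE : partition_function N beta h = z%:E by rewrite massE.
have z0 : 0 < z.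
  rewrite -lte_fin massE //; pose phi0 : surface N := [ffun=> 0%N].
  apply: (@lt_le_trans _ _ (weight beta h phi0)%:E); first by rewrite lte_fin expR_gt0.
  rewrite -(@esum_set1 _ _ phi0 (fun phi => (weight beta h phi)%:E)) ?lee_fin //.
  by apply: esum_sub => // phi; rewrite lee_fin.
under eq_esum => phi _.
  rewrite ZE inver gt_eqF // muleC; over.
rewrite esumZl ?invr_ge0 ?(ltW z0) //.
rewrite -massE // -EFinM lee_fin.
by rewrite mulrC ler_pdivrMr.
Qed.

End Energy.

(** * Low levels *)

Lemma sum_subsets (R : comPzRingType) (I : finType) (Z : {set I}) (x : R) :
  \sum_(D : {set I} | D \subset Z) x ^+ #|D| = (1 + x) ^+ #|Z|.
Proof.
have := @bigA_distr R 0 1 *%R +%R I (fun i => if i \in Z then x else 0) (fun=> 1).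
rewrite (eq_bigr (fun i => if i \in Z then 1 + x else 1)) => [|i _]; last first.
  by case: ifP => _ /=; [apply: addrC|apply: add0r].
rewrite -big_mkcond prodr_const => -> /=; rewrite big_mkcond; apply: eq_bigr => J _.
case: ifP => [/fintype.subsetP JZ|/negbT/fintype.subsetPn[i iJ iZ]].
  rewrite -prodr_const big_mkcond; apply: eq_bigr => i _.
  by case: ifP => // iJ; rewrite JZ.
by rewrite (bigD1 i) //= iJ (negbTE iZ) mul0r.
Qed.

Section EnergyBounds.
Variable N : nat.
Implicit Types (phi psi : surface N).

Lemma sum_outside : (\sum_(x : site N) \sum_(c <- nbrs (pt x)) (~~ box N c : nat) <= 4 * N)%N.
Proof.
have -> : (\sum_(x : site N) \sum_(c <- nbrs (pt x)) (~~ box N c : nat))%N = perim [set: site N]%SET.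
  rewrite /perim; apply: eq_big => [x|x _]; first by rewrite inE.
  apply: eq_bigr => c _; congr (nat_of_bool (~~ _)); apply/boxP/idP => [[y <-]|/indP[y _ <-]].
    by rewrite ind_pt inE.
  by exists y.
have row (f : site N -> 'I_N) (A : {set site N}) : {in A &, injective f} -> (#|A| <= N)%N.
  by move=> fi; rewrite -(card_in_imset fi) (leq_trans (max_card _)) // card_ord.
rewrite perim_directions !mulSn mul0n addn0 !addnA.
have far (y : int * int) : ~~ ind [set: site N]%SET y -> ~~ box N y.
  by apply: contra => /boxP[x <-]; rewrite ind_pt inE.
apply: leq_add; first (apply: leq_add; first apply: leq_add).
- apply: (@row snd) => -[a b] [a' b']; rewrite !inE => /far fa /far fa' /= Eb; congr (_, _) => //.
  apply: val_inj; move: (ltn_ord a) (ltn_ord a') (ltn_ord b) (ltn_ord b') fa fa'; rewrite /box /= -Eb; lia.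
- apply: (@row snd) => -[a b] [a' b']; rewrite !inE => /far fa /far fa' /= Eb; congr (_, _) => //.
  apply: val_inj; move: (ltn_ord a) (ltn_ord a') (ltn_ord b) (ltn_ord b') fa fa'; rewrite /box /= -Eb; lia.
- apply: (@row fst) => -[a b] [a' b']; rewrite !inE => /far fa /far fa' /= Eb; congr (_, _) => //.
  apply: val_inj; move: (ltn_ord a) (ltn_ord a') (ltn_ord b) (ltn_ord b') fa fa'; rewrite /box /= -Eb; lia.
- apply: (@row fst) => -[a b] [a' b']; rewrite !inE => /far fa /far fa' /= Eb; congr (_, _) => //.
  apply: val_inj; move: (ltn_ord a) (ltn_ord a') (ltn_ord b) (ltn_ord b') fa fa'; rewrite /box /= -Eb; lia.
Qed.

Lemma sum_ind (D : {set site N}) :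
  (\sum_(x : site N) \sum_(c <- nbrs (pt x)) (ind D c : nat) <= 4 * #|D|)%N.
Proof.
have cell c : (ind D c : nat) = (\sum_(y in D) (pt y == c : nat))%N.
  have [/indP[y yD <-]|nc] := boolP (ind D c).
    rewrite (bigD1 y) //= eqxx big1 // => z /andP[_ zy].
    by rewrite (inj_eq (@pt_inj N)) (negbTE zy).
  rewrite big1 // => y yD; case: eqP nc => // <-; by rewrite ind_pt yD.
under eq_bigr do under eq_bigr do rewrite cell.
under eq_bigr do rewrite exchange_big.
rewrite exchange_big mulnC -sum_nat_const; apply: leq_sum => y _ /=.
have nb x : (\sum_(c <- nbrs (pt x)) (pt y == c : nat))%N = (pt x \in nbrs (pt y) : nat).
  rewrite -[RHS]/(nn (pt y) (pt x) : nat) nn_sym /nn.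
  rewrite -(count_uniq_mem _ (nbrs_uniq _)) -sum1_count [RHS]big_mkcond.
  by apply: eq_bigr => c _; rewrite /= eq_sym; case: eqP.
under eq_bigr do rewrite nb.
rewrite -big_mkcond sum1_card /=.
have sub : {subset [seq pt x | x <- enum [pred x : site N | pt x \in nbrs (pt y)]] <= nbrs (pt y)}.
  by move=> c /mapP[x]; rewrite mem_enum => xy ->.
have := uniq_leq_size _ sub; rewrite size_map -cardE; apply.
by rewrite map_inj_uniq ?enum_uniq //; apply: pt_inj.
Qed.

(** The comparison is local: the box has at most [4 * N] edges to the outside, and a site is seen
    from at most four neighbors. *)
Lemma energy_le phi psi (D Z : {set site N}) k :
  (forall x c, c \in nbrs (pt x) -> (psi x - hgt psi c <=
     phi x - hgt phi c + ~~ box N c + k * ind D c + ind Z c)%N) ->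
  (energy psi <= energy phi + 4 * N + k * (4 * #|D|) + 4 * #|Z|)%N.
Proof.
move=> H; apply: (@leq_trans (\sum_(x : site N) \sum_(c <- nbrs (pt x))
   (phi x - hgt phi c + ~~ box N c + k * ind D c + ind Z c))%N).
  apply: leq_sum => x _; rewrite big_seq [X in (_ <= X)%N]big_seq.
  by apply: leq_sum => c; apply: H.
under eq_bigr do rewrite !big_split -big_distrr /=.
rewrite !big_split /= -big_distrr /=.
by rewrite !leq_add ?leq_mul ?sum_outside ?sum_ind.
Qed.

End EnergyBounds.

Section UpperLevels.
Variables (R : realType) (N : nat).
Implicit Types (phi psi : surface N) (D : {set site N}) (beta h delta : R).

Definition lift_all phi (D : {set site N}) : surface N :=
  [ffun x => if x \in D then 0%N else (phi x).+1].

Definition lift_nonzero phi (D : {set site N}) : surface N :=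
  [ffun x => if phi x == 0%N then 0%N else if x \in D then 1%N else (phi x).+1].

Definition level phi k : {set site N} := [set x | phi x == k]%SET.

Lemma energy_lift_all phi D : D \subset zeros phi ->
  (energy (lift_all phi D) <= energy phi + 4 * N + 4 * #|D|)%N.
Proof.
move=> /fintype.subsetP DZ.
have := @energy_le N phi (lift_all phi D) D finset.set0 1.
rewrite cards0 muln0 addn0 mul1n; apply => x c _.
have {}DZ y : y \in D -> phi y = 0%N by move=> /DZ; rewrite inE => /eqP.
have [/boxP[y <-]|cb] := boolP (box N c).
  rewrite !hgt_pt !ind_pt !ffunE.
  by case: (boolP (x \in D)) => [/DZ|_]; case: (boolP (y \in D)) => [/DZ|_]; lia.
by rewrite !hgt_out // ffunE; case: ifP; lia.
Qed.

Lemma energy_lift_nonzero phi D k : (0 < k)%N -> D \subset level phi k ->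
  (energy (lift_nonzero phi D) <= energy phi + 4 * N + k * (4 * #|D|) + 4 * #|zeros phi|)%N.
Proof.
move=> k0 /fintype.subsetP DL; apply: energy_le => x c _.
have {}DL y : y \in D -> phi y = k by move=> /DL; rewrite inE => /eqP.
have [/boxP[y <-]|cb] := boolP (box N c).
  rewrite !hgt_pt !ind_pt !ffunE inE.
  case: (eqVneq (phi x) 0%N) => [->|px] //; case: (eqVneq (phi y) 0%N) => [->|py];
    by case: (boolP (x \in D)) => [/DL|_]; case: (boolP (y \in D)) => [/DL|_]; lia.
rewrite !hgt_out // ffunE; case: ifP => // _.
by case: (boolP (x \in D)) => [/DL|_]; lia.
Qed.

Lemma zeros_lift_all phi D : zeros (lift_all phi D) = D.
Proof. by apply/setP => x; rewrite inE ffunE; case: ifP. Qed.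

Lemma zeros_lift_nonzero phi D : zeros (lift_nonzero phi D) = zeros phi.
Proof. by apply/setP => x; rewrite !inE ffunE; case: ifP => // _; case: ifP. Qed.

Let W beta h := @weight R N beta h.

(** The lifted surface remembers [D] as its zero set. [kappa] is the density of zeros at which the
    gain [q] per zero pays for the factor [exp (- 4 beta N)] of the lift with [exp (delta N)] to
    spare. *)
Lemma mass_many_zeros beta h delta : 0 <= beta ->
  summable_weight (W beta h) -> 1 < expR (- h) + expR (- (4 * beta)) ->
  expR (delta * N%:R) *
    mass (W beta h) [set phi | kappa beta h delta * N%:R <= #|zeros phi|%:R] <=
  mass (W beta h) setT.
Proof.
move=> beta0 sw q1; set q := expR (- h) + _ in q1.
apply: (@mass_map R _ _ (index_enum {set site N}) _ _ _ _
  (fun phi D => D \subset zeros phi) lift_all) => //.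
- exact: index_enum_uniq.
- move=> phi D psi D' _ /fintype.subsetP DZ _ /fintype.subsetP DZ' E; have ED : D = D' by rewrite -(zeros_lift_all phi D) E zeros_lift_all.
  split=> //; apply/ffunP => x; have /ffunP/(_ x) := E.
  rewrite !ffunE -ED; case: ifP => [xD _|_ [] //].
  have := DZ' x; rewrite -ED => /(_ xD); have := DZ x xD.
  by rewrite !inE => /eqP -> /eqP ->.
move=> phi Hphi.
apply: (@le_trans _ _ (\sum_(D : {set site N} | D \subset zeros phi)
   expR (- beta * (energy phi)%:R - 4 * beta * N%:R) * expR (h - 4 * beta) ^+ #|D|)); last first.
  apply: ler_sum => D DZ; rewrite /W weightE zeros_lift_all -expRM_natl -expRD ler_expR.
  have : (energy (lift_all phi D))%:R <= (energy phi)%:R + 4 * N%:R + 4 * #|D|%:R :> R.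
    by rewrite -!natrM -!natrD ler_nat energy_lift_all.
  by move=> /(ler_wpM2l beta0); lra.
rewrite -mulr_sumr sum_subsets /W weightE.
(* The factor [exp h] per zero restores the pinning removed by the lift; [q] is the net gain. *)
have -> : 1 + expR (h - 4 * beta) = expR (h + ln q).
  rewrite [RHS]expRD lnK ?posrE ?(lt_trans _ q1) // /q mulrDr -!expRD.
  by rewrite subrr expR0.
rewrite -expRM_natl -!expRD ler_expR.
have lnq : 0 < ln q by rewrite ln_gt0.
have : (4 * beta + delta) * N%:R <= ln q * #|zeros phi|%:R.
  move: Hphi; rewrite /= /kappa -/q mulrAC ler_pdivrMr //.
  by rewrite [ln q * _]mulrC.
lra.
Qed.

Lemma expR_half_le (y : R) : 0 <= y <= 1 -> expR (y / 2) <= 1 + y.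
Proof.
move=> /andP[y0 y1]; have e0 := expR_gt0 (y / 2).
have := expR_ge1Dx (- (y / 2)); rewrite expRN => H.
have : (1 - y / 2) * expR (y / 2) <= 1 by rewrite -ler_pdivlMr // mul1r.
nra.
Qed.

(** After the lift the sites of height 1 are exactly those of [D], so the image determines [D].
    Summing over [D] gives [1 + y >= exp (y / 2)] per site of the level, while the bound on the
    zeros limits the cost of the lift. *)
Lemma mass_full_level beta h (K a : R) k : 0 <= beta -> (0 < k)%N ->
  summable_weight (W beta h) ->
  expR (expR (- (4 * beta * k%:R)) * a / 2 - 4 * beta * (1 + K) * N%:R) *
    mass (W beta h) [set phi | a <= #|level phi k|%:R /\ #|zeros phi|%:R <= K * N%:R] <=
  mass (W beta h) setT.
Proof.
move=> beta0 k0 sw; set y := expR (- _).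
apply: (@mass_map R _ _ (index_enum {set site N}) _ _ _ _
  (fun phi D => D \subset level phi k) lift_nonzero) => //.
- exact: index_enum_uniq.
- move=> phi D psi D' _ /fintype.subsetP DZ _ /fintype.subsetP DZ' E.
  have DE x : x \in D -> phi x = k by move=> /DZ; rewrite inE => /eqP.
  have DE' x : x \in D' -> psi x = k by move=> /DZ'; rewrite inE => /eqP.
  have EZ : zeros phi = zeros psi.
    by rewrite -(zeros_lift_nonzero phi D) E zeros_lift_nonzero.
  have ED : D = D'.
    apply/setP => x; have /ffunP/(_ x) := E; rewrite !ffunE.
    have /setP/(_ x) := EZ; rewrite !inE.
    case: eqP => [p0|p0]; case: eqP => [q0|q0] //; last by do 2 case: ifP => //; lia.
    by move=> _ _; apply/idP/idP => [/DE|/DE']; lia.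
  split=> //; apply/ffunP => x; have /ffunP/(_ x) := E; rewrite !ffunE -ED.
  have /setP/(_ x) := EZ; rewrite !inE.
  case: eqP => [->|p0]; case: eqP => [->|q0] // _.
  case: ifP => [xD _|_ [] //]; rewrite (DE x xD) DE' // -ED //.
move=> phi [/= Ha HZ].
apply: (@le_trans _ _ (\sum_(D : {set site N} | D \subset level phi k)
   (weight beta h phi * expR (- (4 * beta * (1 + K) * N%:R))) * y ^+ #|D|)); last first.
  apply: ler_sum => D DL; rewrite /W !weightE zeros_lift_nonzero -expRM_natl -!expRD ler_expR.
  have : (energy (lift_nonzero phi D))%:R <= (energy phi)%:R + 4 * N%:R +
      k%:R * (4 * #|D|%:R) + 4 * #|zeros phi|%:R :> R.
    by rewrite -!natrM -!natrD ler_nat energy_lift_nonzero.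
  move=> /(ler_wpM2l beta0); move: HZ => /(ler_wpM2l beta0); lra.
rewrite -mulr_sumr sum_subsets -[leRHS]mulrA [leLHS]mulrC ler_wpM2l ?expR_ge0 //.
rewrite addrC expRD ler_wpM2l ?expR_ge0 //.
have y01 : 0 <= y <= 1.
  by rewrite expR_ge0 -[leRHS]expR0 ler_expR oppr_le0 !mulr_ge0.
clearbody y; have /andP[y0 _] := y01.
apply: (@le_trans _ _ (expR (y / 2) ^+ #|level phi k|)).
  rewrite -expRM_natl ler_expR mulrAC [leRHS]mulrC ler_wpM2l //.
  by rewrite divr_ge0.
by rewrite lerXn2r ?nnegrE ?expR_ge0 ?addr_ge0 ?expR_half_le.
Qed.

Lemma typical_heightP beta : 1 <= beta -> (0 < N)%N -> exists n : nat,
  [/\ typical_height beta N = n%:Z, expR (4 * beta * n%:R) <= N%:R &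
      N%:R < expR (4 * beta * n.+1%:R)].
Proof.
move=> b1 N0; have N1 : 1 <= N%:R :> R by rewrite ler1n.
have b0 : 0 < 4 * beta by lra.
have ge0 : 0 <= typical_height beta N.
  by rewrite /typical_height floor_ge0 mulr_ge0 ?ln_ge0 // invr_ge0 ltW.
exists `|typical_height beta N|%N.
have E : typical_height beta N = `|typical_height beta N|%N by rewrite gez0_abs.
have N0' : (N%:R : R) \is Num.pos by rewrite posrE ltr0n.
split=> //.
- have := floor_le ((4 * beta)^-1 * ln (N%:R : R)); rewrite -/(typical_height beta N) E -pmulrn.
  by rewrite mulrC ler_pdivlMr // mulrC -[X in _ -> _ <= X]lnK // ler_expR.
- have := floorD1_gt ((4 * beta)^-1 * ln (N%:R : R)); rewrite -/(typical_height beta N) E.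
  rewrite -[X in _ < X -> _]/((`|typical_height beta N| + 1)%N%:~R) -pmulrn addn1.
  by rewrite mulrC ltr_pdivrMr // mulrC -[X in _ -> X < _]lnK // ltr_expR.
Qed.

Lemma sum_geom_le (x : R) n : 0 <= x < 1 -> \sum_(i < n) x ^+ i <= (1 - x)^-1.
Proof.
move=> /andP[x0 x1]; have E : (1 - x) * (\sum_(i < n) x ^+ i) = 1 - x ^+ n.
  by rewrite -opprB mulNr -subrX1 opprB.
rewrite -[leRHS]mul1r ler_pdivlMr ?subr_gt0 // mulrC E.
by rewrite gerBl exprn_ge0.
Qed.

Lemma card_low_levels phi n m : (m <= n)%N ->
  (#|preim_level phi [in `[0 : int, n%:Z - m%:Z]]%R| <=
    #|zeros phi| + \sum_(i < n - m) #|level phi (n - m - i)|)%N.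
Proof.
move=> mn; rewrite -!sum1_card.
under [X in (_ <= _ + X)%N]eq_bigr do rewrite -sum1_card big_mkcond.
rewrite exchange_big [X in (_ <= X + _)%N]big_mkcond -big_split big_mkcond /=.
apply: leq_sum => x _; rewrite !finset.in_set.
rewrite -[_ \in in_mem^~ _]/((phi x)%:Z \in `[0 : int, n%:Z - m%:Z])%R in_itv /=.
case: ifP => //.
case: (posnP (phi x)) => [->|px] //= xm; rewrite add0n.
have {}xm : (phi x <= n - m)%N by move: xm; rewrite subzn.
have lt : (n - m - phi x < n - m)%N by rewrite ltn_subrL px (leq_trans px xm).
rewrite (bigD1 (Ordinal lt)) //= finset.in_set.
by rewrite subKn // eqxx.
Qed.

End UpperLevels.

Section LowLevels.
Variables (R : realType) (N : nat).
Implicit Types (phi : surface N) (beta h delta : R).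
Let W beta h := @weight R N beta h.

Lemma wetting_gt beta h : 0 < beta -> h < wetting_point beta ->
  1 < expR (- h) + expR (- (4 * beta)).
Proof.
move=> b0; rewrite /wetting_point; set X := expR (4 * beta).
have X1 : 1 < X by rewrite /X expR_gt1 mulr_gt0.
have X0 : 0 < X / (X - 1) by rewrite divr_gt0 ?subr_gt0 // (lt_trans _ X1).
rewrite -ltr_expR lnK ?posrE // => hX.
have : (X / (X - 1))^-1 < (expR h)^-1 by rewrite ltf_pV2 ?posrE ?expR_gt0.
rewrite -expRN invf_div [expR (- (4 * _))]expRN -/X mulrBl divff ?mul1r; last first.
  by rewrite gt_eqF // (lt_trans _ X1).
by lra.
Qed.

Lemma low_levels_bound beta h delta (m : nat) :
  1 <= beta -> 0 < h -> h < wetting_point beta -> (0 < N)%N -> 0 < delta -> (1 <= m)%N ->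
  (sos_prob beta h
     [set phi : surface N |
        (2 * expR (- (2 * beta * m%:R)) * N%:R ^+ 2
         < #|preim_level phi [in `[0, typical_height beta N - m%:Z]]|%:R)%R]
   <= (3 * expR (- (Num.min
                      (2^-1 * expR (2 * beta * m%:R)
                       - 4 * beta * (1 + kappa beta h delta))
                      delta
                    * N%:R)))%:E)%E.
Proof.
move=> b1 h0 hw N0 d0 m1; have b0 : 0 < beta by lra.
have NR : 1 <= N%:R :> R by rewrite ler1n.
have q1 := wetting_gt b0 hw.
set K := kappa _ _ _; set A := [set phi | _].
have K0 : 0 <= K by rewrite /K /kappa divr_ge0 ?ln_ge0 ?ltW //; lra.
set C1 := 4 * beta * (1 + K); set mn := Num.min _ _.
apply: sos_prob_le => [|sw]; first by rewrite mulr_ge0 ?expR_ge0.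
(* For a nonpositive minimum the claimed bound is at least 1. *)
have [mn0|mn0] := leP mn 0.
  rewrite -[leLHS]mul1r ler_pM ?mass_ge0 ?mass_sub //.
  have : 1 <= expR (- (mn * N%:R)) by rewrite -[leLHS]expR0 ler_expR oppr_ge0 mulr_le0_ge0.
  by lra.
have C1m : C1 < 2^-1 * expR (2 * beta * m%:R).
  by move: mn0; rewrite /mn lt_min subr_gt0 => /andP[].
have [n [En nN Nn]] := typical_heightP b1 N0.
set e := expR (- (2 * beta * m%:R)).
have eE : e * expR (2 * beta * m%:R) = 1 by rewrite -expRD addNr expR0.
have e0 : 0 < e by apply: expR_gt0.
set M := mass _ setT; have M0 : 0 <= M by apply: mass_ge0.
have [nm|mn_le] := ltnP n m.
  have -> : A = set0.
    apply/seteqP; split => // phi; rewrite /A /= En.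
    rewrite (_ : preim_level _ _ = finset.set0).
      by rewrite cards0 ltNge mulr_ge0 // mulr_ge0 // ltW.
    apply/setP => x; rewrite finset.in_set finset.in_set0.
    rewrite -[_ \in in_mem^~ _]/((phi x)%:Z \in `[0 : int, n%:Z - m%:Z])%R in_itv /=.
    by apply/negbTE; rewrite -ltNge; apply: (@lt_le_trans _ _ 0%R); rewrite // subr_lt0 ltz_nat.
  rewrite /mass esum_set0 /= mulr_ge0 // mulr_ge0 // expR_ge0.
pose d := (n - m)%N.
(* The allowance [2 e N ^ 2] is split: the level [d - i] may hold [a i] sites, which add up to at
   most three quarters of it, and the zeros get the remaining quarter by [KN]. *)
pose a (i : 'I_d) := expR (- (2 * beta * (m + i)%:R)) * N%:R ^+ 2.
pose Bz := [set phi : surface N | K * N%:R <= #|zeros phi|%:R].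
pose B (i : 'I_d) := [set phi : surface N | a i <= #|level phi (d - i)%N|%:R /\ #|zeros phi|%:R <= K * N%:R].
have emN : expR (2 * beta * m%:R) <= e * N%:R.
  have -> : expR (2 * beta * m%:R) = e * expR (4 * beta * m%:R).
    by rewrite /e -expRD; congr expR; ring.
  rewrite ler_wpM2l ?(ltW e0) // (le_trans _ nN) // ler_expR ler_wpM2l ?ler_nat //; lra.
have KN : K * N%:R <= 2^-1 * e * N%:R ^+ 2.
  rewrite expr2 mulrA ler_wpM2r // -mulrA (le_trans _ (ler_wpM2l _ emN)) //.
  move: C1m; rewrite /C1; nra.
have x3 : 0 <= expR (- (2 * beta)) <= 1 / 3.
  rewrite expR_ge0 /= expRN div1r lef_pV2 ?posrE ?expR_gt0 //.
  by have := expR_ge1Dx (2 * beta); lra.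
have suma : \sum_(i < d) a i <= 3 / 2 * e * N%:R ^+ 2.
  rewrite -mulr_suml ler_wpM2r ?exprn_ge0 //.
  rewrite (eq_bigr (fun i : 'I_d => e * expR (- (2 * beta)) ^+ i)) => [|i _]; last first.
    by rewrite /e -expRM_natl -expRD natrD; congr expR; ring.
  rewrite -mulr_sumr mulrC ler_wpM2r ?(ltW e0) //.
  apply: le_trans (sum_geom_le _ _) _; first by lra.
  rewrite -[leRHS]invrK lef_pV2 ?posrE ?invr_gt0; lra.
have cover phi : A phi -> Bz phi \/ exists i, B i phi.
  rewrite /A /= En => Hphi; have [Zl|Zs] := leP (K * N%:R) #|zeros phi|%:R; first by left.
  have [/existsP[i Hi]|/existsPn none] := boolP [exists i : 'I_d, a i <= #|level phi (d - i)%N|%:R].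
    by right; exists i; split=> //; apply: ltW.
  have := card_low_levels phi mn_le; rewrite -(ler_nat R) natrD natr_sum => H.
  have : \sum_(i < d) (#|level phi (d - i)%N|%:R : R) <= \sum_(i < d) a i.
    by apply: ler_sum => i _; have := none i; rewrite -ltNge => /ltW.
  by move: Hphi H; rewrite -/d -/e; lra.
have massA : mass (W beta h) A <= mass (W beta h) Bz + \sum_(i < d) mass (W beta h) (B i).
  rewrite (massID A Bz) // lerD ?mass_sub //.
  by apply: mass_cover => // phi [/cover[//|[i Bi]] _]; exists i.
apply: le_trans massA _.
have Hz : mass (W beta h) Bz <= expR (- (delta * N%:R)) * M.
  by rewrite expRN -ler_pdivrMl ?invr_gt0 ?expR_gt0 // invrK mass_many_zeros // ltW.
have Hi i : mass (W beta h) (B i) <=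
    expR (- ((2^-1 * expR (2 * beta * m%:R) - C1) * N%:R)) * M * expR (- 1) ^+ i.
  have := @mass_full_level R N beta h K (a i) (d - i)%N (ltW b0) _ sw.
  rewrite subn_gt0 ltn_ord => /(_ isT).
  rewrite -/M -ler_pdivlMl ?expR_gt0 // => /le_trans; apply.
  rewrite -expRN [leRHS]mulrAC ler_wpM2r // -expRM_natl -expRD ler_expR.
  (* The level [d - i] equals [n - (m + i)], and [exp (4 beta n) <= N] because [n] is the typical
     height. *)
  have ij : expR (2 * beta * (m + i)%:R) * N%:R <= expR (- (4 * beta * (d - i)%:R)) * a i.
    have -> : expR (- (4 * beta * (d - i)%:R)) * a i =
        expR (2 * beta * (m + i)%:R) * N%:R * (expR (- (4 * beta * n%:R)) * N%:R).
      have E3 : expR (- (4 * beta * (d - i)%:R)) * expR (- (2 * beta * (m + i)%:R)) =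
          expR (2 * beta * (m + i)%:R) * expR (- (4 * beta * n%:R)).
        rewrite -!expRD; congr expR.
        have -> : n%:R = (d - i)%:R + (m + i)%:R :> R.
          by rewrite -natrD addnCA subnK ?(ltnW (ltn_ord i)) // subnKC.
        by ring.
      by rewrite /a mulrA E3; ring.
    rewrite ler_peMr ?mulr_ge0 ?expR_ge0 //.
    by rewrite expRN mulrC ler_pdivlMr ?expR_gt0 // mul1r.
  have em1 : 1 <= expR (2 * beta * m%:R) by rewrite -[leLHS]expR0 ler_expR !mulr_ge0 // ltW.
  (* A surplus linear in [i] yields the factor [exp (- i)] that makes the union bound over the
     levels converge. *)
  have grow : expR (2 * beta * m%:R) + 2 * i%:R <= expR (2 * beta * (m + i)%:R).
    rewrite natrD mulrDr expRD; have := expR_ge1Dx (2 * beta * i%:R).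
    have : (i%:R : R) <= beta * i%:R by rewrite ler_peMl.
    have : 0 <= i%:R :> R by [].
    clear -em1; nra.
  have growN : (expR (2 * beta * m%:R) + 2 * i%:R) * N%:R <= expR (2 * beta * (m + i)%:R) * N%:R.
    by rewrite ler_wpM2r.
  have iN : i%:R <= i%:R * N%:R :> R by rewrite ler_peMr.
  rewrite -/C1; lra.
(* The levels contribute a geometric sum of at most 2 and the event of many zeros contributes 1,
   whence the constant 3. *)
have Hsum : \sum_(i < d) mass (W beta h) (B i) <=
    expR (- ((2^-1 * expR (2 * beta * m%:R) - C1) * N%:R)) * M * 2.
  apply: le_trans (ler_sum _ (fun i _ => Hi i)) _.
  rewrite -mulr_sumr ler_wpM2l ?mulr_ge0 ?expR_ge0 //.
  have e12 : expR (- 1) <= 1 / 2 :> R.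
    by rewrite expRN div1r lef_pV2 ?posrE ?expR_gt0 //; have := expR_ge1Dx (1 : R); lra.
  have ep : 0 < expR (- 1) :> R by apply: expR_gt0.
  apply: le_trans (sum_geom_le _ _) _; first by lra.
  rewrite -[leRHS]invrK lef_pV2 ?posrE ?invr_gt0; lra.
have l1 : expR (- (delta * N%:R)) <= expR (- (mn * N%:R)).
  by rewrite ler_expR lerN2 ler_wpM2r // /mn ge_min lexx orbT.
have l2 : expR (- ((2^-1 * expR (2 * beta * m%:R) - C1) * N%:R)) <= expR (- (mn * N%:R)).
  by rewrite ler_expR lerN2 ler_wpM2r // /mn ge_min lexx.
have := ler_wpM2r M0 l1; have := ler_wpM2r M0 l2; lra.
Qed.

End LowLevels.

(** * Contours of a surface *)

Section Filling.
Variable N : nat.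
Implicit Types (x y : site N) (B S T : {set site N}).

Definition avoid B (u v : option (site N)) := [&& off B u, off B v & adjo u v].

Lemma within_sym T : symmetric (within T).
Proof. by move=> x y; rewrite /within nn_sym; case: (x \in T) (y \in T) => [] []. Qed.

(** [B] together with its holes. *)
Definition filled B : {set site N} := [set x | ~~ connect (avoid B) None (Some x)]%SET.

Lemma connect_avoid_off B u : connect (avoid B) None u -> off B u.
Proof.
move=> c; rewrite -(@connect_invariant _ _ _ (off B) _ _ _ c) //.
by move=> v w /and3P[-> ->].
Qed.

Lemma sub_filled B : B \subset filled B.
Proof.
apply/fintype.subsetP => x xB; rewrite finset.in_set; apply/negP.
by move/connect_avoid_off; rewrite /= xB.
Qed.

Lemma filled_sub B T : admissible T -> B \subset T -> filled B \subset T.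
Proof.
case/and3P => _ _ /forallP co BT; apply/fintype.subsetP => x.
rewrite finset.in_set; apply: contraR => xT.
have /implyP/(_ xT) := co (Some x).
apply: connect_sub => u v /and3P[uT vT uv]; apply: connect1; apply/and3P; split => //.
  by case: (u) uT => //= z; apply: contra => /(fintype.subsetP BT).
by case: (v) vT => //= z; apply: contra => /(fintype.subsetP BT).
Qed.

(** A path from the outside enters [T] through a site of its inner boundary, hence through [B]. *)
Lemma filled_boundary B T :
  (forall x c, x \in T -> c \in nbrs (pt x) -> ~~ ind T c -> x \in B) -> T \subset filled B.
Proof.
move=> H; apply/fintype.subsetP => x xT; rewrite finset.in_set; apply/negP => co.
have cross u z : off T u -> z \in T -> adjo u (Some z) -> z \in B.
  case: u => [y|] /= yT zT yz.
    by apply: (H z (pt y)); rewrite ?ind_pt // -/(nn _ _) nn_sym.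
  have [c zc cN] := allPn (yz : ~~ all (box N) (nbrs (pt z))); apply: (H z c) => //.
  by apply: contra cN; apply: ind_box.
have : off T None = off T (Some x).
  apply: connect_invariant co => u v /and3P[uB vB uv].
  case uT: (off T u); case vT: (off T v) => //.
    by case: v vB uv vT => // z /= zB uz /negbFE zT; rewrite (cross u z uT zT uz) in zB.
  rewrite adjo_sym in uv.
  by case: u uB uv uT => // z /= zB uz /negbFE zT; rewrite (cross v z vT zT uz) in zB.
by rewrite /= xT.
Qed.

(** [T] is the component of [S] in [filled B]. A neighbor outside [T] is outside [filled B], so it
    is linked to the exterior off [B]; its neighbor in [T] would be linked as well if it were not in
    [B]. *)
Lemma filled_component B S s : s \in S -> S \subset filled B ->
  (forall x, x \in S -> connect (within S) s x) ->
  exists T, [/\ admissible T, S \subset T, T \subset filled B &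
    forall x c, x \in T -> c \in nbrs (pt x) -> ~~ ind T c -> x \in B /\ ~~ ind B c].
Proof.
move=> sS /fintype.subsetP SF Sconn; set F := filled B in SF *.
have sF := SF s sS.
pose T : {set site N} := [set z | connect (within F) s z]%SET.
have TF x : x \in T -> x \in F.
  rewrite finset.in_set => c; rewrite -(@connect_invariant _ _ _ (fun z => z \in F) _ _ _ c) //.
  by move=> u v /and3P[-> ->].
have ext x y : x \in T -> y \in F -> nn (pt x) (pt y) -> y \in T.
  move=> xT yF xy; have xF := TF x xT; move: xT; rewrite !finset.in_set => c.
  by apply: connect_trans c (connect1 _); rewrite /within xF yF.
have sT : s \in T by rewrite finset.in_set.
have conn x : x \in T -> connect (within T) s x.
  rewrite finset.in_set => /connectP[p].
  elim/last_ind: p x => [|p z IHp] x; first by move=> _ ->.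
  rewrite rcons_path last_rcons => /andP[pp /and3P[lF zF lz]] ->.
  have lT : last s p \in T by rewrite finset.in_set; apply/connectP; exists p.
  apply: connect_trans (IHp _ pp erefl) (connect1 _).
  by rewrite /within lT lz (ext _ _ lT zF lz).
have reachB u : connect (avoid B) None u -> connect (avoid T) None u.
  move/connectP=> [p]; elim/last_ind: p u => [|p z IHp] u; first by move=> _ ->.
  rewrite rcons_path last_rcons => /andP[pp pz] ->.
  have offT v : connect (avoid B) None v -> off T v.
    by case: v => //= y c; apply/negP => /TF; rewrite finset.in_set c.
  have lc : connect (avoid B) None (last None p) by apply/connectP; exists p.
  apply: connect_trans (IHp _ pp erefl) (connect1 _).
  rewrite /avoid !offT //; last by apply: connect_trans lc (connect1 pz).
  by case/and3P: pz.
(* If [x] lies in another component of [filled B], the path to the right of [x] stays off [T], since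
   a site of [T] cannot be adjacent to that component, until it leaves [filled B] or the box. *)
have coT x : x \notin T -> connect (avoid T) None (Some x).
  have [k] := ubnP (N - x.1)%N; elim: k x => // k IHk x xk xT.
  have [xF|xO] := boolP (x \in F); last first.
    by apply: reachB; move: xO; rewrite finset.in_set negbK.
  have cx : ((pt x).1 + 1, (pt x).2)%R \in nbrs (pt x) by rewrite inE eqxx.
  have [/boxP[y Ey]|cb] := boolP (box N ((pt x).1 + 1, (pt x).2)%R); last first.
    apply: connect1; rewrite /avoid /off xT /adjo andTb; apply/allPn.
    by exists ((pt x).1 + 1, (pt x).2)%R.
  have xy : nn (pt x) (pt y) by rewrite Ey.
  have yT : y \notin T by apply: contra xT => yT; apply: ext yT xF _; rewrite nn_sym.
  have ly : (N - y.1 < N - x.1)%N.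
    move: (ltn_ord y.1) (congr1 fst Ey) => /=; lia.
  apply: connect_trans (IHk y (leq_trans ly xk) yT) (connect1 _).
  by rewrite /avoid /= xT yT nn_sym.
exists T; split.
- apply/and3P; split.
  + by apply/set0Pn; exists s.
  + apply/forall_inP => x /conn xc; apply/forall_inP => y /conn.
    by apply: connect_trans; rewrite (sym_connect_sym (@within_sym T)).
  + by apply/forallP => -[x|]; apply/implyP => // /coT.
- apply/fintype.subsetP => x /Sconn; rewrite finset.in_set; apply: connect_sub => u v.
  by case/and3P => /SF uF /SF vF uv; apply: connect1; rewrite /within uF vF.
- by apply/fintype.subsetP => x; apply: TF.
move=> x c xT xc nT; have xF := TF x xT.
have [u [uO ux uE]] : exists u, [/\ connect (avoid B) None u, adjo u (Some x) & ~~ ind B c].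
  have [/boxP[y Ey]|cN] := boolP (box N c).
    have xy : nn (pt x) (pt y) by rewrite Ey.
    have yF : y \notin F by apply: contra nT => yF; rewrite -Ey ind_pt (ext x).
    move: yF; rewrite finset.in_set negbK => yO; exists (Some y); rewrite /= nn_sym -Ey ind_pt.
    by split => //; apply: connect_avoid_off yO.
  exists None; split; [exact: connect0|by apply/allPn; exists c|].
  by apply: contra cN; apply: ind_box.
split=> //; apply: contraTT xF => xB; rewrite finset.in_set negbK.
have offu := connect_avoid_off uO; apply: connect_trans uO (connect1 _).
by rewrite /avoid ux offu /= xB.
Qed.

End Filling.

(** * Tilted weights and the raising of surfaces inside a contour *)

Section Tilted.
Variables (R : realType) (N : nat).
Implicit Types (phi psi : surface N) (x y : site N) (S T Y D : {set site N}).

(** In [energy] an edge is charged to its higher end, which for a sunken set is the outer one; so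
    the perimeter is recounted from outside. *)
Lemma perim_reverse S :
  (forall x c, x \in S -> c \in nbrs (pt x) -> ~~ ind S c -> box N c) ->
  perim S = (\sum_y \sum_(c <- nbrs (pt y)) ((y \notin S) && ind S c))%N.
Proof.
move=> H; pose F x y : nat := [&& x \in S, y \notin S & nn (pt x) (pt y)].
transitivity (\sum_x \sum_y F x y)%N.
  rewrite /perim big_mkcond; apply: eq_bigr => x _; case: ifP => xS; last first.
    by rewrite big1 // => y _; rewrite /F xS.
  rewrite (bigID (box N)) /= [X in (_ + X)%N]big_seq_cond [X in (_ + X)%N]big1 => [|c /andP[xc cN]]; last first.
    by case: (boolP (ind S c)) => // nS; case/negP: cN; apply: (H x c).
  rewrite addn0 sum_nbrs big_mkcond; apply: eq_bigr => y _.
  by rewrite /F xS ind_pt andbC; case: (nn _ _); case: (y \in S).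
rewrite exchange_big; apply: eq_bigr => y _.
rewrite [RHS](bigID (box N)) /= [X in (_ + X)%N]big1 => [|c cN]; last first.
  by case: (boolP (ind S c)) => [/ind_box cb|]; [rewrite cb in cN|rewrite andbF].
rewrite addn0 (sum_nbrs (fun c => (y \notin S) && ind S c : nat)) [RHS]big_mkcond.
apply: eq_bigr => x _.
by rewrite /F ind_pt nn_sym; case: (nn _ _); case: (y \in S); case: (x \in S).
Qed.

Definition above L phi : {set site N} := [set x | (L <= phi x)%N]%SET.

Definition tilted (beta h tau : R) L phi : R :=
  weight beta h phi * expR (tau * #|above L phi|%:R).

Lemma tiltedE beta h tau L phi : tilted beta h tau L phi =
  expR (- beta * (energy phi)%:R + h * #|zeros phi|%:R + tau * #|above L phi|%:R).
Proof. by rewrite /tilted weightE -expRD. Qed.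

Lemma summable_tilted beta h tau L : 0 <= tau -> summable_weight (@weight R N beta h) ->
  summable_weight (tilted beta h tau L).
Proof.
move=> t0 sw; apply: (@summable_le _ _ _ _ (expR (tau * #|[set: site N]%SET|%:R)) sw).
  exact: expR_ge0.
move=> phi; rewrite /tilted mulr_ge0 ?expR_ge0 //= mulrC ler_wpM2r ?expR_ge0 //.
by rewrite ler_expR ler_wpM2l // ler_nat subset_leq_card // finset.subsetT.
Qed.

Definition outlines (l : nat) T phi := forall x c, x \in T -> c \in nbrs (pt x) ->
  ~~ ind T c -> (l <= phi x)%N /\ (hgt phi c < l)%N.

Definition raise S phi D : surface N :=
  [ffun x => if x \in S then (if x \in D then 0 else (phi x).+1)%N else phi x].

Section Raise.
Variables (i : nat) (S D : {set site N}) (phi : surface N).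
Hypothesis phi_S : forall x c, x \in S -> c \in nbrs (pt x) -> ~~ ind S c ->
  (phi x <= i < hgt phi c)%N.
Hypothesis D_zeros : D \subset zeros phi :&: S.

Lemma D_in x : x \in D -> phi x = 0%N /\ x \in S.
Proof. by move/(fintype.subsetP D_zeros); rewrite !inE => /andP[/eqP]. Qed.

(** The outer neighbors are strictly higher, so raising shortens each boundary edge by one. A site
    of [D] stays one unit behind and costs at most one on each of its four edges. *)
Lemma energy_raise : (energy (raise S phi D) + perim S <= energy phi + 4 * #|D|)%N.
Proof.
rewrite perim_reverse; last first.
  move=> x c xS xc nS; have /andP[_] := phi_S xS xc nS.
  by apply: contraTT => /hgt_out ->.
apply: leq_trans (leq_add (leqnn _) (sum_ind D)).
rewrite /energy -!big_split; apply: leq_sum => y _ /=.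
rewrite -!big_split /= big_seq [X in (_ <= X)%N]big_seq; apply: leq_sum => c yc.
have [/boxP[x Ex]|cN] := boolP (box N c); last first.
  have nS T : ind T c = false by apply/negbTE; apply: contra cN; apply: ind_box.
  rewrite !nS !hgt_out // andbF !addn0 !subn0 ffunE; case: ifP => // yS.
  by have := phi_S yS yc; rewrite nS hgt_out // ltn0 andbF => /(_ isT).
have yx : nn (pt y) (pt x) by rewrite Ex.
rewrite -Ex !hgt_pt !ind_pt !ffunE.
case: (boolP (y \in S)) => yS; case: (boolP (x \in S)) => xS /=.
- case: (boolP (y \in D)) => yD //; case: (boolP (x \in D)) => [/D_in[-> _]|xD]; lia.
- have := phi_S yS yx; rewrite ind_pt hgt_pt xS => /(_ isT).
  case: ifP => _ /andP[yi ix]; rewrite addn0 ?sub0n //.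
  by have /eqP -> := leq_ltn_trans yi ix.
- rewrite nn_sym in yx; have := phi_S xS yx; rewrite ind_pt hgt_pt yS => /(_ isT).
  by case: (boolP (x \in D)) => [/D_in[-> _]|xD] /andP[] /=; move: (phi x) (phi y) => a b; lia.
- by rewrite addn0 leq_addr.
Qed.

Lemma zeros_raise : (#|zeros (raise S phi D)| + #|zeros phi :&: S| = #|zeros phi| + #|D|)%N.
Proof.
have E : zeros (raise S phi D) = (zeros phi :\: S) :|: D.
  apply/setP => x; rewrite !inE ffunE; case: (boolP (x \in S)) => xS /=.
    by case: ifP.
  case: (boolP (x \in D)) => [/D_in[_ xS']|_]; last by rewrite orbF.
  by rewrite xS' in xS.
have disj : (zeros phi :\: S) :&: D = finset.set0.
  apply/setP => x; rewrite !inE; apply/negP => /andP[/andP[xS _] /D_in[_ xS']].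
  by rewrite xS' in xS.
by rewrite E cardsU disj cards0 subn0 -[in RHS](cardsID S (zeros phi)) addnAC [(_ + #|zeros phi :&: S|)%N]addnC.
Qed.

Lemma raise_ge x : (phi x <= raise S phi D x)%N.
Proof. by rewrite ffunE; case: ifP => // xS; case: ifP => [/D_in[->]|]. Qed.

Lemma above_raise L : (#|above L phi| <= #|above L (raise S phi D)|)%N.
Proof.
apply: subset_leq_card; apply/fintype.subsetP => x; rewrite !inE => Lx.
exact: leq_trans (raise_ge x).
Qed.

End Raise.

Lemma raise_inj S phi psi D D' :
  D \subset zeros phi :&: S -> D' \subset zeros psi :&: S ->
  raise S phi D = raise S psi D' -> phi = psi /\ D = D'.
Proof.
move=> HD HD' E.
have ED : D = D'.
  apply/setP => x; have /ffunP/(_ x) := E; rewrite !ffunE.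
  case: (boolP (x \in S)) => xS; first by do 2 case: ifP => //.
  move=> _; apply/idP/idP => [/(D_in HD)|/(D_in HD')] [_]; by rewrite (negbTE xS).
split=> //; apply/ffunP => x; have /ffunP/(_ x) := E; rewrite !ffunE -ED.
case: ifP => // xS; case: ifP => [xD _|_ [] //].
by have [-> _] := D_in HD xD; rewrite ED in xD; have [-> _] := D_in HD' xD.
Qed.

(* Letting an arbitrary subset of the lifted zeros fall back to 0 compensates for
   the lost pinning exactly when [h] is at most the wetting point. *)
Lemma tilted_raise beta h tau L i S phi : 0 <= beta -> 0 <= tau ->
  1 <= expR (- h) + expR (- (4 * beta)) ->
  (forall x c, x \in S -> c \in nbrs (pt x) -> ~~ ind S c -> (phi x <= i < hgt phi c)%N) ->
  expR (beta * (perim S)%:R) * tilted beta h tau L phi <=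
  \sum_(D : {set site N} | D \subset zeros phi :&: S) tilted beta h tau L (raise S phi D).
Proof.
move=> b0 t0 q1 HS; set z := zeros phi :&: S.
apply: (@le_trans _ _ (\sum_(D : {set site N} | D \subset z)
   expR (beta * (perim S)%:R) * tilted beta h tau L phi * expR (- h * #|z|%:R) *
     expR (h - 4 * beta) ^+ #|D|)).
  rewrite -mulr_sumr sum_subsets -[leLHS]mulr1 -[leRHS]mulrA.
  rewrite ler_wpM2l ?mulr_ge0 ?expR_ge0 //.
  have -> : expR (- h * #|z|%:R) = expR (- h) ^+ #|z| by rewrite -expRM_natr.
  rewrite -exprMn exprn_ege1 // mulrDr mulr1 -expRD.
  by rewrite addrA addNr add0r.
apply: ler_sum => D Dz; rewrite !tiltedE -expRM_natl -!expRD ler_expR.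
have e1 : (energy (raise S phi D))%:R + (perim S)%:R <= (energy phi)%:R + 4 * #|D|%:R :> R.
  by rewrite -natrM -!natrD ler_nat (energy_raise HS Dz).
have e2 : #|zeros (raise S phi D)|%:R + #|z|%:R = #|zeros phi|%:R + #|D|%:R :> R.
  by rewrite -!natrD (zeros_raise Dz).
have e3 : tau * #|above L phi|%:R <= tau * #|above L (raise S phi D)|%:R.
  by rewrite ler_wpM2l // ler_nat (above_raise Dz).
have e4 : h * #|zeros (raise S phi D)|%:R = h * #|zeros phi|%:R + h * #|D|%:R - h * #|z|%:R.
  by rewrite -mulrDr -mulrBr -e2 addrK.
move/(ler_wpM2l b0): e1; lra.
Qed.

End Tilted.

Lemma admissible_within N (S : {set site N}) s x : admissible S -> s \in S -> x \in S ->
  connect (within S) s x.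
Proof. by case/and3P => _ /forall_inP conn _ sS xS; have /forall_inP := conn s sS; apply. Qed.

(** * Zeros inside a contour *)

Section DownwardContours.
Variables (R : realType) (N : nat) (beta h tau : R) (L l : nat) (T Y : {set site N}).
Hypotheses (beta1 : 1 <= beta) (tau0 : 0 <= tau)
  (q1 : 1 <= expR (- h) + expR (- (4 * beta)))
  (sw : summable_weight (@weight R N beta h)) (aT : admissible T).
Implicit Types (phi : surface N) (S : {set site N}).

Let wt := @tilted R N beta h tau L.

(** [Y] holds the sites already conditioned to be positive in the induction of [mass_no_zeros];
    raising preserves this condition. *)
Definition floored : set (surface N) :=
  [set phi | outlines l T phi /\ forall x, x \in Y -> (0 < phi x)%N].

Definition low i phi : {set site N} := [set x in T | (phi x <= i)%N]%SET.

Let sT : summable_weight wt. Proof. exact: summable_tilted. Qed.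

(** The condition [r <= l] keeps truncation out of [l - r]. *)
Definition sunken r S : R :=
  mass wt [set phi | [/\ (r <= l)%N, floored phi & S \subset filled (low (l - r) phi)]].

(** A contour around [S] at level [l - r.+1] stays inside [T], so raising its interior leaves [T] a
    contour at level [l]. Afterwards its inner boundary has height at most [l - r], which is the
    event in [sunken r]. *)
Lemma sunken_step r S s : s \in S -> (forall x, x \in S -> connect (within S) s x) ->
  sunken r.+1 S <= \sum_(S' : {set site N} | admissible S' && (S \subset S'))
     expR (- (beta * (perim S')%:R)) * sunken r S'.
Proof.
move=> sS Sconn; have [rl|lr] := ltnP r l; last first.
  rewrite /sunken (_ : [set phi | _] = set0).
    by rewrite /mass esum_set0 sumr_ge0 // => S' _; rewrite mulr_ge0 ?expR_ge0 ?mass_ge0.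
  by apply/seteqP; split=> // phi [] /=; rewrite ltnNge lr.
set i := (l - r.+1)%N; have iE : (l - r = i.+1)%N by rewrite /i subnSK.
have il : (i < l)%N by rewrite /i; lia.
pose E S' : set (surface N) := [set phi | [/\ floored phi, S' \subset T &
  forall x c, x \in S' -> c \in nbrs (pt x) -> ~~ ind S' c -> (phi x <= i < hgt phi c)%N]].
apply: (@le_trans _ _ (\sum_(S' : {set site N} | admissible S' && (S \subset S')) mass wt (E S'))).
  apply: mass_cover => // phi [_ Gphi Sphi].
  have [S' [aS' SS' S'F HS']] := filled_component sS Sphi Sconn.
  exists S'; first by rewrite aS'.
  have lowT : low i phi \subset T by apply/fintype.subsetP => x; rewrite inE => /andP[].
  have S'T : S' \subset T by apply: fintype.subset_trans S'F (filled_sub aT lowT).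
  split=> // x c xS' xc nc; have [xlow clow] := HS' x c xS' xc nc.
  move: xlow; rewrite inE => /andP[xT xi]; rewrite xi /=.
  have [/indP[z zT Ez]|cT] := boolP (ind T c); last first.
    by have [/(leq_trans il)] := Gphi.1 x c xT xc cT; rewrite ltnNge xi.
  by move: clow; rewrite -Ez ind_pt hgt_pt inE zT /= -ltnNge.
apply: ler_sum => S' /andP[aS' SS'].
rewrite expRN ler_pdivlMl ?expR_gt0 //.
apply: (@mass_map _ _ _ (index_enum {set site N}) _ _ _ _
  (fun phi D => D \subset zeros phi :&: S') (fun phi D => raise S' phi D)) => //.
- exact: index_enum_uniq.
- move=> phi D [[Gphi Yphi] S'T HS'] DZ; rewrite iE; split; [exact: ltnW| |].
    split=> [x c xT xc cT|x /Yphi]; last by move/leq_trans; apply; apply: raise_ge DZ x.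
    have [lx cl] := Gphi x c xT xc cT; split; first exact: leq_trans lx (raise_ge DZ x).
    have [/boxP[z Ez]|cN] := boolP (box N c); last by rewrite hgt_out // (leq_trans _ il).
    move: cl cT; rewrite -Ez !hgt_pt ind_pt ffunE => zl zT.
    by rewrite ifN //; apply: contra zT; apply: (fintype.subsetP S'T).
  apply: filled_boundary => x c xS' xc nc; rewrite inE (fintype.subsetP S'T) //=.
  rewrite ffunE xS'; case: ifP => // _.
  by have /andP[] := HS' x c xS' xc nc.
- by move=> phi D psi D' _ DZ _ DZ'; apply: raise_inj.
- move=> phi [Gphi S'T HS']; apply: tilted_raise HS' => //.
  by apply: le_trans beta1.
Qed.

Lemma sunken_le r S : sunken r S <= mass wt floored.
Proof. by apply: mass_sub => // phi []. Qed.

End DownwardContours.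

(** The rate per level has to be the full [4 beta] of a single site, but [superharmonic_chain]
    concedes one factor [exp beta]. It is therefore applied to sets with at least two sites, whose
    perimeter of at least 6 leaves the rate [5 beta], and the singleton gets a recursion of its
    own. *)
Lemma zero_mass_bound (R : realType) (c G : R) : 0 < c -> c < 1 -> 1 <= G ->
  exists C : R, 1 <= C /\
  forall (N : nat) (beta h tau : R) (L l : nat) (T Y : {set site N}) (y : site N),
  (forall y : site N,
     \sum_(T : {set site N} | admissible T && (y \in T)) expR (- (c * (perim T)%:R)) <= G) ->
  1 <= beta -> 0 <= tau -> 1 <= expR (- h) + expR (- (4 * beta)) ->
  summable_weight (@weight R N beta h) -> admissible T -> y \in T ->
  mass (tilted beta h tau L) [set phi | floored l T Y phi /\ phi y = 0%N] <=
  C * expR (- (4 * beta * l%:R)) * mass (tilted beta h tau L) (floored l T Y).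
Proof.
move=> c0 c1 G1; have [A [A1 chain]] := superharmonic_chain c0 c1 G1.
pose C1 := A * G * expR 6.
have C10 : 0 <= C1 by rewrite !mulr_ge0 ?expR_ge0 //; lra.
exists (1 + C1); split; first by rewrite lerDl.
move=> N beta h tau L l T Y y HG b1 t0 q1 sw aT yT.
set wt := tilted _ _ _ _; set W := mass wt (floored l T Y).
have sT : summable_weight wt by apply: summable_tilted.
have W0 : 0 <= W by apply: mass_ge0.
pose u := @sunken R N beta h tau L l T Y.
have b0 : 0 <= beta by apply: le_trans b1.
have large r S : admissible S -> y \in S -> (1 < #|S|)%N ->
    u r S <= A * expR (- (5 * beta * r%:R)) * W.
  move=> aS yS S2.
  apply: (@chain beta beta 6%N 2%N N y u W b1) => //; rewrite ?subrr //.
  - by rewrite divr_ge0 // subr_ge0 ltW.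
  - by move=> U _; apply: perim_ge6.
  - by move=> U; exact: (sunken_le L l T Y t0 sw 0 U).
  - move=> k U aU yU; apply: (sunken_step L l Y b1 t0 q1 sw aT k yU).
    by move=> x; apply: admissible_within.
(* Relative to [exp (- 4 beta r)], a transition to larger sets adds at most [C1 * E r] at stage [r].
   As [E] at least halves at each stage, [C1 - C1 * E r] dominates the sum of these additions. *)
pose E r : R := expR (- (beta * r%:R)).
have single r : u r [set y]%SET <= expR (- (4 * beta * r%:R)) * (1 + C1 - C1 * E r) * W.
  elim: r => [|r IHr].
    apply: le_trans (sunken_le L l T Y t0 sw 0 _) _.
    by rewrite /E !mulr0 oppr0 expR0 mulr1 addrK !mul1r.
  have conn x : x \in [set y]%SET -> connect (within [set y]%SET) y x.
    by rewrite inE => /eqP ->; apply: connect0.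
  apply: le_trans (sunken_step L l Y b1 t0 q1 sw aT r (set11 y) conn) _.
  have sub_y (S : {set site N}) : ([set y]%SET \subset S) = (y \in S) by rewrite finset.sub1set.
  under eq_bigl do rewrite sub_y.
  rewrite (bigID (fun S : {set site N} => (1 < #|S|)%N)) /=.
  have first_le : \sum_(S : {set site N} | admissible S && (y \in S) && (1 < #|S|)%N)
      expR (- (beta * (perim S)%:R)) * u r S <= C1 * expR (- (5 * beta * r.+1%:R)) * W.
    apply: (@le_trans _ _ (\sum_(S : {set site N} | admissible S && (y \in S))
      expR (- (c * (perim S)%:R)) * (expR 6 * expR (- (6 * beta)) *
        (A * expR (- (5 * beta * r%:R)) * W)))).
      rewrite big_mkcondr; apply: ler_sum => S /andP[aS yS]; case: ifP => S2; last first.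
        by rewrite !mulr_ge0 ?expR_ge0 //; lra.
      rewrite mulrA ler_pM ?expR_ge0 ?mass_ge0 ?large // -!expRD ler_expR.
      have : 6 <= (perim S)%:R :> R by rewrite (ler_nat R 6) perim_ge6.
      by clear -b1 c0 c1; nra.
    rewrite -mulr_suml.
    have -> : C1 * expR (- (5 * beta * r.+1%:R)) * W =
      G * (expR 6 * expR (- (5 * beta)) * (A * expR (- (5 * beta * r%:R)) * W)).
      have -> : expR (- (5 * beta * r.+1%:R)) = expR (- (5 * beta)) * expR (- (5 * beta * r%:R)).
        by rewrite -expRD -natr1; congr expR; ring.
      by rewrite /C1; ring.
    rewrite ler_pM ?HG ?sumr_ge0 //.
    - by rewrite !mulr_ge0 ?expR_ge0 //; lra.
    rewrite ler_wpM2r ?mulr_ge0 ?expR_ge0 //; first by lra.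
    rewrite ler_wpM2l ?expR_ge0 // ler_expR; lra.
  have second_le : \sum_(S : {set site N} | admissible S && (y \in S) && ~~ (1 < #|S|)%N)
      expR (- (beta * (perim S)%:R)) * u r S <= expR (- (4 * beta)) * u r [set y]%SET.
    have only (S : {set site N}) : y \in S -> ~~ (1 < #|S|)%N -> S = [set y]%SET.
      move=> yS S1; apply/esym/eqP; rewrite eqEcard finset.sub1set yS cards1 -leqNgt in S1 *.
      by rewrite S1.
    apply: (@le_trans _ _ (\sum_(S : {set site N} | S == [set y]%SET)
       expR (- (beta * (perim S)%:R)) * u r S)).
      rewrite big_mkcond [leRHS]big_mkcond; apply: ler_sum => S _.
      case: ifP => [/andP[/andP[_ yS] S1]|_]; first by rewrite (only S yS S1) eqxx.
      by case: ifP => // _; rewrite mulr_ge0 ?expR_ge0 ?mass_ge0.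
    rewrite big_pred1_eq ler_wpM2r ?mass_ge0 // ler_expR lerN2 mulrC ler_wpM2l //.
    by rewrite (ler_nat R 4) (@perim_ge4 _ _ y) // inE.
  apply: le_trans (lerD first_le second_le) _.
  have Er : E r.+1 * 2 <= E r.
    have -> : E r = E r.+1 * expR beta by rewrite /E -expRD -natr1; congr expR; ring.
    rewrite ler_wpM2l ?expR_ge0 //.
    by have := expR_ge1Dx beta; lra.
  have E4 : expR (- (4 * beta)) * expR (- (4 * beta * r%:R)) = expR (- (4 * beta * r.+1%:R)).
    by rewrite -expRD -natr1; congr expR; ring.
  have E5 : expR (- (5 * beta * r.+1%:R)) = expR (- (4 * beta * r.+1%:R)) * E r.+1.
    by rewrite /E -expRD; congr expR; ring.
  have := ler_wpM2l (expR_ge0 (- (4 * beta))) IHr.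
  rewrite E5 -(addrC (expR (- (4 * beta)) * _)) => H; apply: le_trans (lerD H (lexx _)) _.
  set lhs := (X in X <= _).
  have -> : lhs = expR (- (4 * beta * r.+1%:R)) * (1 + C1 - C1 * E r + C1 * E r.+1) * W.
    by rewrite /lhs -E4; ring.
  rewrite ler_wpM2r // ler_wpM2l ?expR_ge0 //.
  by have := ler_wpM2l C10 Er; clear; lra.
apply: (@le_trans _ _ (u l [set y]%SET)).
  apply: mass_sub => // phi [Gphi y0]; split=> //; rewrite subnn finset.sub1set.
  by apply: (fintype.subsetP (sub_filled _)); rewrite inE yT y0.
apply: le_trans (single l) _; rewrite ler_wpM2r // mulrC ler_wpM2r ?expR_ge0 //.
by rewrite gerBl mulr_ge0 ?expR_ge0.
Qed.

(** * High levels *)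

Section UpwardContours.
Variables (R : realType) (N : nat) (beta h tau : R) (L : nat).
Hypotheses (beta1 : 1 <= beta) (h0 : 0 <= h) (tau0 : 0 <= tau)
  (sw : summable_weight (@weight R N beta h)).
Implicit Types (phi : surface N) (S T : {set site N}).

Let wt := @tilted R N beta h tau L.

Let sT : summable_weight wt. Proof. exact: summable_tilted. Qed.

Definition lower T phi : surface N := [ffun x => if x \in T then (phi x).-1 else phi x].

Lemma energy_lower l T phi : outlines l T phi -> (forall x, x \in T -> (0 < phi x)%N) ->
  (energy (lower T phi) + perim T <= energy phi)%N.
Proof.
move=> Tphi pos; rewrite /perim big_mkcond /energy -big_split; apply: leq_sum => y _ /=.
have -> : (if y \in T then (\sum_(c <- nbrs (pt y)) ~~ ind T c)%N else 0%N) =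
    (\sum_(c <- nbrs (pt y)) ((y \in T) && ~~ ind T c))%N.
  by case: ifP => // _; rewrite big1.
rewrite -big_split /= big_seq [X in (_ <= X)%N]big_seq; apply: leq_sum => c yc.
have [/boxP[x Ex]|cN] := boolP (box N c); last first.
  have nT : ~~ ind T c by apply: contra cN; apply: ind_box.
  rewrite !hgt_out // nT andbT !subn0 ffunE; case: ifP => [yT|]; last by rewrite addn0.
  by rewrite addn1 prednK ?pos.
have yx : nn (pt y) (pt x) by rewrite Ex.
rewrite -Ex !hgt_pt ind_pt !ffunE.
case: (boolP (y \in T)) => yT; case: (boolP (x \in T)) => xT /=; rewrite ?addn0 //.
- by move: (pos x xT) (pos y yT); move: (phi x) (phi y) => a b; lia.
- have := Tphi _ _ yT yx; rewrite ind_pt hgt_pt => /(_ xT) [].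
  by move: (phi x) (phi y) => a b; lia.
- rewrite nn_sym in yx; have := Tphi _ _ xT yx; rewrite ind_pt hgt_pt => /(_ yT) [].
  by move: (phi x) (phi y) => a b; lia.
Qed.

(** Each boundary edge gains [exp beta]; the tilt loses at most [exp tau] per site, and new zeros
    only help because [h >= 0]. The inner boundary drops from at least [l] to at least [l.-1]. *)
Lemma mass_lower l T : expR (beta * (perim T)%:R) * mass wt (floored l T T) <=
  expR (tau * #|T|%:R) * mass wt [set phi | T \subset filled (above l.-1 phi)].
Proof.
rewrite -ler_pdivrMl ?expR_gt0 // mulrA -expRN -expRD.
apply: (@mass_map1 _ _ _ _ _ _ (lower T)) => //.
- move=> phi [Tphi _]; apply: filled_boundary => x c xT xc cT.
  have [lx _] := Tphi x c xT xc cT.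
  by rewrite finset.in_set ffunE xT -!subn1 leq_sub2r.
- move=> phi psi [_ pos] [_ pos'] /ffunP E; apply/ffunP => x; have := E x.
  rewrite !ffunE; case: ifP => // xT E'.
  by rewrite -(prednK (pos x xT)) -(prednK (pos' x xT)) E'.
move=> phi [Tphi pos]; rewrite /wt !tiltedE -expRD ler_expR.
have e1 : (energy (lower T phi))%:R + (perim T)%:R <= (energy phi)%:R :> R.
  by rewrite -natrD ler_nat (energy_lower Tphi pos).
have e2 : h * #|zeros phi|%:R <= h * #|zeros (lower T phi)|%:R.
  rewrite ler_wpM2l // ler_nat subset_leq_card //; apply/fintype.subsetP => x.
  by rewrite !finset.in_set ffunE => /eqP ->; case: ifP.
have e3 : tau * #|above L phi|%:R <= tau * (#|T|%:R + #|above L (lower T phi)|%:R).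
  rewrite ler_wpM2l // -natrD ler_nat.
  apply: leq_trans (leq_card_setU _ _).1; apply: subset_leq_card.
  apply/fintype.subsetP => x; rewrite finset.in_setU !finset.in_set ffunE.
  by case: ifP => // xT ->; rewrite ?orbT.
move/(ler_wpM2l (le_trans ler01 beta1)): e1; lra.
Qed.

(** Zeros are excluded one site at a time, each at the price of a factor [1 - p >= exp (- 2 p)]; the
    hypothesis is therefore required for every set [Y] of sites treated before. *)
Lemma mass_no_zeros (p : R) l T : 0 <= p <= 1 / 2 ->
  (forall Y y, y \in T -> mass wt [set phi | floored l T Y phi /\ phi y = 0%N] <=
     p * mass wt (floored l T Y)) ->
  mass wt [set phi | outlines l T phi] <= expR (2 * p * #|T|%:R) * mass wt (floored l T T).
Proof.
move=> /andP[p0 p1] H.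
have step s : {subset s <= T} -> (1 - p) ^+ (size s) * mass wt [set phi | outlines l T phi] <=
    mass wt (floored l T [set x in s]%SET).
  elim: s => [|y s IHs] sub.
    by rewrite mul1r; apply: mass_sub => // phi Tphi; split=> // x; rewrite inE.
  have yT : y \in T by apply: sub; rewrite inE eqxx.
  have sub' : {subset s <= T} by move=> x xs; apply: sub; rewrite inE xs orbT.
  have {}IHs := IHs sub'.
  rewrite /= exprS -mulrA.
  have := ler_wpM2l (_ : 0 <= 1 - p) IHs; rewrite subr_ge0 => /(_ _)/le_trans; apply; first by lra.
  rewrite mulrBl mul1r lerBlDr addrC [leLHS](massID _ [set phi : surface N | phi y = 0%N]) //.
  apply: lerD; first exact: H.
  apply: mass_sub => // phi [[Tphi pos] y0]; split=> // x.
  rewrite inE inE => /orP[/eqP ->|xs]; last by apply: pos; rewrite inE.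
  by rewrite lt0n; apply/eqP.
have Hs := step (enum T) (fun x xT => etrans (esym (mem_enum T x)) xT).
rewrite -cardE in Hs.
have ET : [set x in enum T]%SET = T by apply/setP => x; rewrite inE mem_enum.
rewrite ET in Hs; rewrite -ler_pdivrMl ?expR_gt0 // -expRN; apply: le_trans Hs.
rewrite ler_wpM2r ?mass_ge0 //.
have -> : expR (- (2 * p * #|T|%:R)) = expR (- (2 * p)) ^+ #|T|.
  by rewrite -expRM_natl; congr expR; ring.
rewrite lerXn2r ?nnegrE ?expR_ge0 ?subr_ge0 //; first by lra.
rewrite expRN -[leLHS]mul1r ler_pdivrMr ?expR_gt0 //.
by have := expR_ge1Dx (2 * p); nra.
Qed.

(* [Hzero] is the conclusion of [zero_mass_bound]; a zero is so unlikely above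
   level [log N / (4 beta)] that forbidding all zeros inside a contour [T] costs
   only a small multiple of [perim T]. *)
Lemma raised_step (C eps : R) l0 r S s : 0 <= C -> 0 <= eps ->
  (forall l T Y y, admissible T -> y \in T ->
     mass wt [set phi | floored l T Y phi /\ phi y = 0%N] <=
     C * expR (- (4 * beta * l%:R)) * mass wt (floored l T Y)) ->
  C * expR (- (4 * beta * l0%:R)) <= 1 / 2 ->
  2 * (C * expR (- (4 * beta * l0%:R))) * N%:R <= eps / 2 -> tau * N%:R <= eps / 2 ->
  s \in S -> (forall x, x \in S -> connect (within S) s x) ->
  mass wt [set phi | S \subset filled (above (l0 + r.+1) phi)] <=
  \sum_(T : {set site N} | admissible T && (S \subset T))
    expR (- ((beta - eps) * (perim T)%:R)) *
      mass wt [set phi | T \subset filled (above (l0 + r) phi)].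
Proof.
move=> C0 eps0 Hzero Hp HN tauN sS Sconn; set l := (l0 + r.+1)%N.
apply: (@le_trans _ _ (\sum_(T : {set site N} | admissible T && (S \subset T))
   mass wt [set phi | outlines l T phi])).
  apply: mass_cover => // phi Sphi.
  have [T [aT ST TF HT]] := filled_component sS Sphi Sconn.
  exists T; first by rewrite aT.
  move=> x c xT xc nc; have [] := HT x c xT xc nc.
  rewrite finset.in_set => -> cl; split=> //.
  have [/boxP[z Ez]|cN] := boolP (box N c); last by rewrite hgt_out // /l addnS.
  by move: cl; rewrite -Ez ind_pt hgt_pt finset.in_set -ltnNge.
apply: ler_sum => T /andP[aT ST].
set p := C * expR (- (4 * beta * l%:R)).
have pl0 : p <= C * expR (- (4 * beta * l0%:R)).
  rewrite ler_wpM2l // ler_expR lerN2 ler_wpM2l ?ler_nat ?leq_addr // mulr_ge0 //.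
  exact: le_trans beta1.
have p0 : 0 <= p by rewrite mulr_ge0 ?expR_ge0.
have p1 : p <= 1 / 2 by apply: le_trans Hp.
have p01 : 0 <= p <= 1 / 2 by rewrite p0 p1.
apply: le_trans (mass_no_zeros p01 (fun Y y yT => Hzero l T Y y aT yT)) _.
have := mass_lower l T; rewrite -ler_pdivlMl ?expR_gt0 // => Hlow.
have := ler_wpM2l (expR_ge0 (2 * p * #|T|%:R)) Hlow => /le_trans; apply.
have -> : l.-1 = (l0 + r)%N by rewrite /l addnS.
rewrite -expRN !mulrA -!expRD ler_wpM2r ?mass_ge0 // ler_expR.
(* This converts both losses proportional to [#|T|], from zeros and from the tilt, into [eps / 2]
   times the perimeter. *)
have cT : #|T|%:R <= N%:R * (perim T)%:R :> R by rewrite -natrM ler_nat card_le_perim.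
have P0 : 0 <= (perim T)%:R :> R by [].
have e1 : 2 * p * #|T|%:R <= eps / 2 * (perim T)%:R.
  apply: le_trans (ler_wpM2l _ cT) _; first by rewrite mulr_ge0.
  rewrite mulrA ler_wpM2r // (le_trans _ HN) // ler_wpM2r // ler_wpM2l //.
have e2 : tau * #|T|%:R <= eps / 2 * (perim T)%:R.
  by apply: le_trans (ler_wpM2l _ cT) _; rewrite // mulrA ler_wpM2r.
rewrite /p !mulrA in e1 e2; lra.
Qed.

End UpwardContours.

(** Above level [l0] zeros inside contours are rare enough for lowering to lose only [eps] in the
    rate. The smallest perimeter 4 then yields [exp (- 3 beta)] per level, and the surplus over
    [exp (- 2 beta)] absorbs all constants once [m >= K]. *)
Lemma high_site_bound (R : realType) : exists (theta : R) (K : nat), 0 < theta /\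
  forall (beta h : R) (N n m : nat) (y : site N),
  1 <= beta -> 0 <= h -> h < wetting_point beta -> (0 < N)%N ->
  N%:R < expR (4 * beta * n.+1%:R) -> (K <= m)%N ->
  summable_weight (@weight R N beta h) ->
  mass (tilted beta h (theta / N%:R) (n + m)) [set phi : surface N | (n + m <= phi y)%N] <=
  expR (- (2 * beta * m%:R)) / 2 * mass (@tilted R N beta h (theta / N%:R) (n + m)) setT.
Proof.
have [c [G [c0 c1 G1 HG]]] := peierls_sum R.
have [C [C1 HC]] := zero_mass_bound c0 c1 G1.
have [A [A1 chain]] := superharmonic_chain c0 c1 G1.
(* The largest loss [beta - b] that [superharmonic_chain] tolerates. *)
pose eps := Num.min (100^-1) ((1 - c) / 2).
have eps0 : 0 < eps by rewrite /eps lt_min invr_gt0 ltr0n divr_gt0 ?subr_gt0.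
have eps1 : eps <= 100^-1 by rewrite /eps ge_min lexx.
have eps2 : eps <= (1 - c) / 2 by rewrite /eps ge_min lexx orbT.
have [k kP] : exists k : nat, 4 * C <= eps * k%:R.
  exists (Num.trunc (4 * C / eps)).+1.
  have : 4 * C / eps < (Num.trunc (4 * C / eps)).+1%:R by apply: truncnS_gt.
  by rewrite ltr_pdivrMr // [_ * eps]mulrC => /ltW.
have [k2 k2P] : exists k2 : nat, 2 * G * A <= k2%:R.
  by exists (Num.trunc (2 * G * A)).+1; apply/ltW/truncnS_gt.
(* The rate [3 beta] holds over [r = m - k - 2] levels, and [3 r - 2 m >= k2] amounts to
   [m >= 3 k + 6 + k2]. *)
exists (eps / 2), (3 * k + 6 + k2)%N; split; first by rewrite divr_gt0.
move=> beta h N n m y b1 h0 hw N0 Nn Km sw.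
set tau := eps / 2 / N%:R; set wt := tilted _ _ _ _.
have NR : 0 < N%:R :> R by rewrite ltr0n.
have tau0 : 0 <= tau by rewrite divr_ge0 ?divr_ge0 // ltW.
have b0 : 0 < beta by lra.
have q1 := ltW (wetting_gt b0 hw).
have sT : summable_weight wt by apply: summable_tilted.
set W := mass wt setT; have W0 : 0 <= W by apply: mass_ge0.
pose l0 := (n + k.+1)%N.
(* [N < exp (4 beta (n + 1))] reduces the claim to a bound on [C exp (- 4 k)], and
   [x exp (- x) <= 1] at [x = 4 k] gives [eps / 4] by the choice of [k]. *)
have Cl0 : C * expR (- (4 * beta * l0%:R)) * N%:R <= eps / 4.
  have e1 : expR (- (4 * beta * l0%:R)) * N%:R <= expR (- (4 * k%:R)).
    apply: (@le_trans _ _ (expR (- (4 * beta * l0%:R)) * expR (4 * beta * n.+1%:R))).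
      by rewrite ler_wpM2l ?expR_ge0 // ltW.
    rewrite -expRD ler_expR /l0 natrD -!natr1.
    have : 0 <= (beta - 1) * k%:R by rewrite mulr_ge0 // subr_ge0.
    lra.
  have e2 : expR (- (4 * k%:R)) * (4 * k%:R) <= 1 :> R.
    rewrite expRN mulrC ler_pdivrMr ?expR_gt0 // mul1r.
    by have := expR_ge1Dx (4 * k%:R : R); lra.
  have e3 := expR_gt0 (- (4 * k%:R) : R).
  have e4 : C * (expR (- (4 * beta * l0%:R)) * N%:R) <= C * expR (- (4 * k%:R)).
    by rewrite ler_wpM2l // (le_trans ler01).
  have e5 : 4 * C * expR (- (4 * k%:R)) <= eps * k%:R * expR (- (4 * k%:R)).
    by rewrite ler_wpM2r // ltW.
  have e6 : eps * (expR (- (4 * k%:R)) * (4 * k%:R)) <= eps by rewrite ler_piMr // ltW.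
  rewrite -mulrA; apply: le_trans e4 _; lra.
have C0 : 0 <= C by lra.
have Cp : C * expR (- (4 * beta * l0%:R)) <= 1 / 2.
  apply: (@le_trans _ _ (C * expR (- (4 * beta * l0%:R)) * N%:R)).
    by rewrite ler_peMr ?mulr_ge0 ?expR_ge0 // ler1n.
  by apply: le_trans Cl0 _; lra.
have tauN : tau * N%:R <= eps / 2 by rewrite /tau divfK // gt_eqF.
pose u r (T : {set site N}) := mass wt [set phi | T \subset filled (above (l0 + r) phi)].
have Hzero l (T Y : {set site N}) z : admissible T -> z \in T ->
    mass wt [set phi | floored l T Y phi /\ phi z = 0%N] <=
    C * expR (- (4 * beta * l%:R)) * mass wt (floored l T Y).
  by move=> aT zT; apply: HC => // z'; apply: HG.
have step r (S : {set site N}) s : s \in S -> (forall x, x \in S -> connect (within S) s x) ->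
   u r.+1 S <= \sum_(T : {set site N} | admissible T && (S \subset T))
      expR (- ((beta - eps) * (perim T)%:R)) * u r T.
  move=> sS conn; apply: (@raised_step R N beta h tau (n + m) b1 h0 tau0 sw C eps l0 r S s) => //.
  - exact: ltW.
  - by rewrite -mulrA; lra.
have large r (S : {set site N}) : admissible S -> y \in S ->
    u r S <= A * expR (- (3 * beta * r%:R)) * W.
  move=> aS yS.
  apply: (@chain beta (beta - eps) 4%N 1%N N y u W b1) => //.
  - by rewrite gerBl ltW.
  - by rewrite opprB addrC subrK.
  - by rewrite opprB addrC subrK.
  - by move=> T yT _; apply: perim_ge4 yT.
  - by move=> T; apply: mass_sub.
  - move=> r' T aT yT; apply: (step r' T y yT).
    by move=> x; apply: admissible_within.
  - by apply/card_gt0P; exists y.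
pose r := (m - k.+2)%N.
have rE : (l0 + r.+1 = n + m)%N by rewrite /l0 /r; clear -Km; lia.
apply: (@le_trans _ _ (u r.+1 [set y]%SET)).
  apply: mass_sub => // phi /= Hy; rewrite finset.sub1set rE.
  by apply: (fintype.subsetP (sub_filled _)); rewrite finset.in_set.
have conn x : x \in [set y]%SET -> connect (within [set y]%SET) y x.
  by rewrite finset.in_set1 => /eqP ->; apply: connect0.
(* One step of the recursion leads from the singleton to admissible sets, for which [large] is
   available. *)
apply: le_trans (step r _ y (set11 y) conn) _.
apply: (@le_trans _ _ (\sum_(T : {set site N} | admissible T && (y \in T))
   expR (- (c * (perim T)%:R)) * (A * expR (- (3 * beta * r%:R)) * W))).
  rewrite [leLHS]big_mkcond [leRHS]big_mkcond; apply: ler_sum => T _.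
  rewrite finset.sub1set; case: ifP => // /andP[aT yT].
  rewrite ler_pM ?expR_ge0 ?mass_ge0 ?large // ler_expR lerN2 ler_wpM2r //; lra.
rewrite -mulr_suml mulrA ler_wpM2r //.
apply: (@le_trans _ _ (G * (A * expR (- (3 * beta * r%:R))))).
  rewrite ler_wpM2r ?HG // mulr_ge0 ?expR_ge0 //; lra.
have grow : k2%:R <= expR (3 * beta * r%:R - 2 * beta * m%:R).
  have : 1 + k2%:R <= expR k2%:R :> R by apply: expR_ge1Dx.
  have : expR k2%:R <= expR (3 * beta * r%:R - 2 * beta * m%:R) :> R.
    rewrite ler_expR.
    have : k2%:R <= 3 * r%:R - 2 * m%:R :> R.
      rewrite lerBrDr -!natrM -natrD ler_nat /r; clear -Km; lia.
    move=> H; have := ler_wpM2l (ltW b0) H.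
    have : 1 * k2%:R <= beta * k2%:R by rewrite ler_wpM2r.
    lra.
  lra.
have -> : expR (- (2 * beta * m%:R)) / 2 =
    expR (3 * beta * r%:R - 2 * beta * m%:R) * expR (- (3 * beta * r%:R)) / 2.
  by rewrite -expRD; congr (expR _ / 2); ring.
have e0 := expR_ge0 (- (3 * beta * r%:R)).
have := ler_wpM2r e0 (le_trans k2P grow); lra.
Qed.

(* Chernoff for the tilted measure, whose normalization is controlled by Jensen. *)
Lemma many_high_sites (R : realType) N (w : surface N -> R) (tau a : R) L :
  summable_weight w -> 0 <= tau -> 0 <= a ->
  let wt := fun phi => w phi * expR (tau * #|above L phi|%:R) in
  summable_weight wt ->
  \sum_x mass wt [set phi | (L <= phi x)%N] <= a / 2 * mass wt setT ->
  mass w [set phi | a < #|above L phi|%:R] <= expR (- (tau * a / 2)) * mass w setT.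
Proof.
(* Exceeding [a] gains [exp (2 k)] under the tilt and the normalization loses [exp k], so
   [exp (- k)] remains. *)
move=> sw tau0 a0 wt sT Hsum; set k := tau * a / 2.
have k0 : 0 <= k by rewrite !mulr_ge0.
have [w0 _] := sw.
have chernoff : expR (2 * k) * mass w [set phi | a < #|above L phi|%:R] <= mass wt setT.
  apply: (@le_trans _ _ (mass wt [set phi | a < #|above L phi|%:R])); last exact: mass_sub.
  apply: (mass_le sw sT (expR_ge0 _)) => phi /= Ha.
  rewrite /wt mulrC ler_wpM2l // ler_expR.
  by have := ler_wpM2l tau0 (ltW Ha); rewrite /k; lra.
pose B x := [set phi : surface N | (L <= phi x)%N].
have cardE phi : #|above L phi|%:R = \sum_x (phi \in B x)%:R :> R.
  rewrite -sum1_card natr_sum big_mkcond; apply: eq_bigr => x _.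
  rewrite finset.in_set; case: ifP => [Lx|/negP Lx]; first by rewrite mem_set.
  by rewrite memNset.
pose w1 phi := expR k * w phi.
pose w2 phi := wt phi * \sum_x (phi \in B x)%:R.
have s1 : summable_weight w1.
  by apply: (summable_le sw (expR_ge0 k)) => phi; rewrite mulr_ge0 ?expR_ge0 /=.
have s2 : summable_weight w2.
  apply: (summable_le sT (ler0n _ #|[set: site N]%SET|)) => phi.
  have [wt0 _] := sT; rewrite /w2 -cardE mulr_ge0 //= mulrC ler_wpM2r // ler_nat.
  by rewrite subset_leq_card // finset.subsetT.
have s3 : summable_weight (fun phi => tau * w2 phi).
  by apply: (summable_le s2 tau0) => phi; rewrite lexx mulr_ge0 //; case: s2.
(* The inequality [exp (k - t) >= 1 + k - t] is multiplied by the tilted weight and summed. By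
   [Hsum] the tilted count contributes at most [k] times the tilted mass, which cancels against the
   left side and leaves [wtZ]. *)
have jensen : (1 + k) * mass wt setT <= mass (fun phi => w1 phi + tau * w2 phi) setT.
  apply: (mass_le sT (summableD s1 s3) (addr_ge0 ler01 k0)) => phi _.
  rewrite /w1 /w2 -cardE /wt; set t := tau * _.
  have -> : tau * (w phi * expR t * #|above L phi|%:R) = w phi * expR t * t by rewrite /t; ring.
  have -> : expR k * w phi = w phi * expR t * expR (k - t).
    by rewrite -mulrA -expRD addrC subrK mulrC.
  rewrite mulrC -mulrDr ler_wpM2l ?mulr_ge0 ?expR_ge0 //.
  by have := expR_ge1Dx (k - t); lra.
move: jensen; rewrite massD // massZ // massZ ?expR_ge0 // mass_sum // => jensen.
have wtZ : mass wt setT <= expR k * mass w setT.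
  have := ler_wpM2l tau0 Hsum; move: jensen; rewrite /k; lra.
have : expR (2 * k) * mass w [set phi | a < #|above L phi|%:R] <= expR k * mass w setT.
  exact: le_trans chernoff wtZ.
rewrite -ler_pdivlMl ?expR_gt0 // -expRN mulrA -expRD => /le_trans; apply.
rewrite ler_wpM2r ?mass_ge0 // ler_expR; lra.
Qed.

Lemma high_levels_bound (R : realType) : exists C K : R, [/\ 0 < C, 0 < K &
    forall (beta h : R) (N m : nat),
      1 <= beta -> 0 < h -> h < wetting_point beta ->
      (1 <= N)%N -> K <= m%:R ->
      (sos_prob beta h
         [set phi : surface N |
            (expR (- (2 * beta * m%:R)) * N%:R ^+ 2
             < #|preim_level phi [in `[typical_height beta N + m%:Z, +oo[]|%:R)%R]
       <= expeR (- (C%:E * (expR (- (2 * beta * m%:R)) * N%:R)%:E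
                   * Order.min 1
                       ((expR (- (2 * beta * m%:R)) * N%:R)%:E
                        * ((ln N%:R ^+ 8)%:E)^-1))))%E].
Proof.
have [theta [K [theta0 Hsite]]] := high_site_bound R.
(* The successor makes the threshold positive even when [K] is 0. *)
exists (theta / 2), (K.+1)%:R; split; rewrite ?divr_gt0 ?ltr0n //.
move=> beta h N m b1 h0 hw N0 Km; have {}Km : (K <= m)%N.
  by apply: ltnW; rewrite -(ler_nat R).
have NR : 0 < N%:R :> R by rewrite ltr0n.
have [n [En nN Nn]] := typical_heightP b1 N0.
set e := expR (- (2 * beta * m%:R)); have e0 : 0 < e by apply: expR_gt0.
(* The minimum is at most 1, so the exponent with 1 in its place gives a stronger bound, also for
   [N = 1]. *)
apply: (@le_trans _ _ (expR (- (theta / 2 * (e * N%:R))))%:E); last first.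
  rewrite -[leLHS]/(expeR (- (theta / 2 * (e * N%:R)))%:E) lee_expeR EFinN leeN2 -EFinM.
  rewrite -[leRHS]mule1 lee_wpmul2l // ?ge_min ?lexx // lee_fin.
  by rewrite !mulr_ge0 ?divr_ge0 // ltW.
apply: sos_prob_le => [|sw]; first exact: expR_ge0.
have preimE phi : preim_level phi [in `[typical_height beta N + m%:Z, +oo[]%R = above (n + m) phi.
  apply/setP => x; rewrite !finset.in_set En.
  by rewrite -[_ \in in_mem^~ _]/((phi x)%:Z \in `[n%:Z + m%:Z, +oo[)%R in_itv /= andbT.
under eq_set do rewrite preimE.
have tau0 : 0 <= theta / N%:R by rewrite divr_ge0 // ltW.
have -> : theta / 2 * (e * N%:R) = theta / N%:R * (e * N%:R ^+ 2) / 2.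
  by field; rewrite gt_eqF.
apply: many_high_sites => //.
- by rewrite mulr_ge0 ?exprn_ge0 // ltW.
- exact: summable_tilted.
apply: le_trans (ler_sum _ (fun x _ => Hsite beta h N n m x b1 (ltW h0) hw N0 Nn Km sw)) _.
rewrite sumr_const card_prod card_ord -/e -[leLHS]mulr_natl natrM -/(tilted _ _ _ _).
rewrite expr2; lra.
Qed.

Local Open Scope ring_scope.

(* The inverse of an extended real satisfies 0^-1 = +oo, so the factor
   (ln N)^-8 in the first part is +oo when N = 1. *)
Theorem theorem1p1 (R : realType) :
  (exists C K : R, [/\ 0 < C, 0 < K &
    forall (beta h : R) (N m : nat),
      1 <= beta -> 0 < h -> h < wetting_point beta ->
      (1 <= N)%N -> K <= m%:R ->
      (sos_prob beta h
         [set phi : surface N |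
            (expR (- (2 * beta * m%:R)) * N%:R ^+ 2
             < #|preim_level phi [in `[typical_height beta N + m%:Z, +oo[]|%:R)%R]
       <= expeR (- (C%:E * (expR (- (2 * beta * m%:R)) * N%:R)%:E
                   * Order.min 1
                       ((expR (- (2 * beta * m%:R)) * N%:R)%:E
                        * ((ln N%:R ^+ 8)%:E)^-1))))%E])
  /\
  (forall (beta h delta : R) (N m : nat),
     1 <= beta -> 0 < h -> h < wetting_point beta ->
     (1 <= N)%N -> 0 < delta -> (1 <= m)%N ->
     (sos_prob beta h
        [set phi : surface N |
           (2 * expR (- (2 * beta * m%:R)) * N%:R ^+ 2
            < #|preim_level phi [in `[0, typical_height beta N - m%:Z]]|%:R)%R]
      <= (3 * expR (- (Num.min
                         (2^-1 * expR (2 * beta * m%:R)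
                          - 4 * beta * (1 + kappa beta h delta))
                         delta
                       * N%:R)))%:E)%E).
Proof.
split; first exact: high_levels_bound.
by move=> beta h delta N m b1 h0 hw N1 d0 m1; apply: low_levels_bound.
Qed.
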